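(* Let $(X,d,A)$ be a metric pair. A set $S\subset(\overline{D}_\infty(X,A),W_\infty)$ is relatively compact if and only if $S$ is uniformly upper finite and upper relatively compact. For $p\in[1,\infty)$, a set $S\subset(\overline{D}_p(X,A),W_p)$ is relatively compact if and only if $S$ is uniformly upper finite, upper relatively compact, and uniformly $p$-vanishing.
   Context: A metric on $X$ is a map $d:X\times X\to[0,\infty]$ with $d(x,x)=0$, symmetry and the triangle inequality (infinite distances allowed, $d(x,y)=0$ need not imply $x=y$); a metric pair $(X,d,A)$ is such a space with a closed subset $A$. Write $d(x,A)=\inf_{a\in A}d(x,a)$, $A^\delta=\{x:d(x,A)<\delta\}$ for $\delta\in(0,\infty]$. $\overline{D}(X,A)$ is the set of countable formal sums $\hat\alpha=\sum_{i\in I}x_i$ of points of $X\setminus A$ (repetitions allowed); $0$ the empty sum; $|\alpha|=|I|$; the support of $\alpha$ is the set of points appearing in $\hat\alpha$. A matching of $\hat\alpha=\sum_{i\in I}x_i$, $\hat\beta=\sum_{j\in J}y_j$ is a formal sum $\sum_{k\in K}(x_k,y_{\varphi(k)})+\sum_{i\in I\setminus K}(x_i,z_i)+\sum_{j\in J\setminus\varphi(K)}(w_j,y_j)$ with $K\subset I$, $\varphi$ injective, $z_i,w_j\in A$; its $p$-cost is the $\ell^p$ norm (sup norm if $p=\infty$) of the distances of paired points; $W_p$ is the infimum of $p$-costs. $u_\delta(\alpha)$, $\ell_\delta(\alpha)$ are the restrictions of $\hat\alpha$ to $X\setminus A^\delta$ and to $A^\delta\setminus A$. For $p<\infty$, $\overline{D}_p(X,A)=\{\alpha: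 |u_\infty(\alpha)|<\infty,\ W_p(\ell_\infty(\alpha),0)<\infty\}$; $\overline{D}_\infty(X,A)=\{\alpha:|u_\delta(\alpha)|<\infty\ \forall\delta>0\}$. A subset of a topological space is relatively compact if its closure is compact. For $S\subset\overline{D}(X,A)$: $S$ is uniformly upper finite if for every $\varepsilon>0$ there is $M_\varepsilon\ge0$ with $|u_\varepsilon(\alpha)|\le M_\varepsilon$ for all $\alpha\in S$; $S$ is upper relatively compact if for every $\varepsilon>0$ the set $u_\varepsilon(S)=\bigcup_{\alpha\in S}\mathrm{supp}(u_\varepsilon(\alpha))$ is relatively compact in $(X,d)$; $S$ is uniformly $p$-vanishing if for every $\varepsilon>0$ there is $\delta>0$ with $W_p(\ell_\delta(\alpha),0)<\varepsilon$ for all $\alpha\in S$. *)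

(* Defs.v *)
From HB Require Import structures.
From mathcomp Require Import all_boot all_order all_algebra.
From mathcomp Require Import all_classical all_reals all_analysis.
Set Implicit Arguments. Unset Strict Implicit. Unset Printing Implicit Defensive.
Import Order.TTheory GRing.Theory Num.Theory.
Local Open Scope classical_set_scope.
Local Open Scope ring_scope.

Section Defs.
Variable R : realType.

Definition is_ext_metric (T : Type) (d : T -> T -> \bar R) : Prop :=
  (forall x y, (0 <= d x y)%E) /\
  (forall x, d x x = 0%E) /\
  (forall x y, d x y = d y x) /\
  (forall x y z, (d x z <= d x y + d y z)%E).

Section Topo.
Variables (T : Type) (dist : T -> T -> \bar R) (Y : set T).

Definition ball_in (x : T) (eps : R) : set T :=
  [set y | Y y /\ (dist x y < eps%:E)%E].

Definition open_in (U : set T) : Prop :=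
  U `<=` Y /\ forall x, U x -> exists2 eps : R, 0 < eps & ball_in x eps `<=` U.

Definition closure_in (S : set T) : set T :=
  [set x | Y x /\ forall eps : R, 0 < eps -> exists2 y, S y & (dist x y < eps%:E)%E].

Definition compact_in (K : set T) : Prop :=
  K `<=` Y /\
  forall (I : Type) (U : I -> set T),
    (forall i, open_in (U i)) -> K `<=` \bigcup_i U i ->
    exists2 F : set I, finite_set F & K `<=` \bigcup_(i in F) U i.

Definition rel_compact_in (S : set T) : Prop := compact_in (closure_in S).
End Topo.

Definition closed_for (T : Type) (d : T -> T -> \bar R) (A : set T) : Prop :=
  closure_in d setT A `<=` A.

Definition metric_pair (X : Type) (d : X -> X -> \bar R) (A : set X) : Prop :=
  is_ext_metric d /\ closed_for d A.

Section Diagrams.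
Variables (X : Type) (d : X -> X -> \bar R) (A : set X).

(* d(x,A) = inf_{a in A} d(x,a)  (= +oo if A is empty) *)
Definition dist_set (x : X) : \bar R := ereal_inf [set d x a | a in A].

(* A countable formal sum  sum_{i in I} x_i : the index set I is a subset of
   nat (every countable index set can be reindexed into nat), x = pt. *)
Record fsum := FSum { idx : set nat; pt : nat -> X }.

Definition in_Dbar (a : fsum) : Prop := forall i, idx a i -> ~ A (pt a i).

(* the empty sum 0 (pt is irrelevant; we reuse that of a given sum, since X
   may be empty) *)
Definition fzero_like (a : fsum) : fsum := FSum set0 (pt a).

Definition card_le (I : set nat) (M : R) : Prop :=
  exists2 s : seq nat, ((size s)%:R <= M) & I `<=` [set` s].

Definition restrict (a : fsum) (P : set X) : fsum :=
  FSum (idx a `&` [set i | P (pt a i)]) (pt a).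

Definition u_ (delta : \bar R) (a : fsum) : fsum :=
  restrict a [set x | ~ (dist_set x < delta)%E].
Definition l_ (delta : \bar R) (a : fsum) : fsum :=
  restrict a [set x | (dist_set x < delta)%E /\ ~ A x].

Definition supp (a : fsum) : set X := [set pt a i | i in idx a].

Record matching_data := Matching {
  mK : set nat; mphi : nat -> nat; mz : nat -> X; mw : nat -> X }.

Definition is_matching (a b : fsum) (m : matching_data) : Prop :=
  [/\ mK m `<=` idx a,
      (forall k, mK m k -> idx b (mphi m k)),
      (forall k1 k2, mK m k1 -> mK m k2 -> mphi m k1 = mphi m k2 -> k1 = k2),
      (forall i, idx a i -> ~ mK m i -> A (mz m i)) &
      (forall j, idx b j -> ~ (mphi m @` mK m) j -> A (mw m j))].

Definition pcost (p : R) (a b : fsum) (m : matching_data) : \bar R :=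
  poweR (\esum_(k in mK m) poweR (d (pt a k) (pt b (mphi m k))) p
       + \esum_(i in idx a `\` mK m) poweR (d (pt a i) (mz m i)) p
       + \esum_(j in idx b `\` (mphi m @` mK m)) poweR (d (mw m j) (pt b j)) p)%E
        p^-1.

(* oo-cost: sup norm of the distances of paired points (0 for the empty family) *)
Definition infcost (a b : fsum) (m : matching_data) : \bar R :=
  ereal_sup ([set 0%E] `|`
    [set d (pt a k) (pt b (mphi m k)) | k in mK m] `|`
    [set d (pt a i) (mz m i) | i in idx a `\` mK m] `|`
    [set d (mw m j) (pt b j) | j in idx b `\` (mphi m @` mK m)]).

Definition Wp (p : R) (a b : fsum) : \bar R :=
  ereal_inf [set pcost p a b m | m in is_matching a b].
Definition Winf (a b : fsum) : \bar R :=
  ereal_inf [set infcost a b m | m in is_matching a b].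

Definition in_Dp (p : R) (a : fsum) : Prop :=
  [/\ in_Dbar a, finite_set (idx (u_ +oo%E a)) &
      (Wp p (l_ +oo%E a) (fzero_like a) < +oo)%E].

Definition in_Dinf (a : fsum) : Prop :=
  in_Dbar a /\ forall delta : R, 0 < delta -> finite_set (idx (u_ delta%:E a)).

Definition unif_upper_finite (S : set fsum) : Prop :=
  forall eps : R, 0 < eps -> exists M : R, 0 <= M /\
    forall a, S a -> card_le (idx (u_ eps%:E a)) M.

Definition upper_rel_compact (S : set fsum) : Prop :=
  forall eps : R, 0 < eps ->
    rel_compact_in d setT (\bigcup_(a in S) supp (u_ eps%:E a)).

Definition unif_p_vanishing (p : R) (S : set fsum) : Prop :=
  forall eps : R, 0 < eps -> exists2 delta : R, 0 < delta &
    forall a, S a -> (Wp p (l_ delta%:E a) (fzero_like a) < eps%:E)%E.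

End Diagrams.
End Defs.

(* Main.v *)
(** Both cases are treated at once by an exponent in [option R]. Up to
constants, closeness in [W_q] is closeness for couplings that record the
displacement of every point, and a subset is relatively compact iff every
ultrafilter on it has a limit. Given such a limit, a point of a nearby sum that
is far from [A] has a partner among finitely many points of the limit; this
gives the three conditions. Conversely, split the points of each sum into levels
according to their distance to [A] and enumerate each level: finitely many labels
occur per level, each label that occurs almost surely has an ultralimit in [X]
by compactness, and the sum of these points is the limit, the tails being
controlled uniformly by the vanishing condition. *)

Require Import Defs.
From mathcomp Require Import all_boot all_order all_algebra.
From mathcomp Require Import all_classical all_reals all_analysis.
From mathcomp Require Import ring lra.
Set Implicit Arguments.
Unset Strict Implicit.
Unset Printing Implicit Defensive.
Import Order.TTheory GRing.Theory Num.Theory.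
Local Open Scope classical_set_scope.
Local Open Scope ring_scope.

(** * Compactness and ultrafilters *)

(** Two obstacles shape the proof. The exact triangle inequality of [Wp] would require Minkowski for
    countable families. For compactness it is enough that two points close to a third are close to
    each other, with any loss of constants, so only [weak_metric] is ever proved for [W]; the
    factors 4, 8 and 32 below are such losses. The other obstacle is that the sums in [S] have no
    common index set and that [X] need not be complete. Labels serve as the common index set, and
    upper relative compactness yields the limit of each label separately, without any Cauchy
    argument. A level is bounded away from [A], so limit points cannot fall into [A]; it carries
    finitely many labels, so pointwise closeness there upgrades to closeness in norm. Beyond a given
    level no matching is attempted: both tails are sent to [A], and the tail of the limit inherits
    its bound by a Fatou type argument on finite subfamilies. *)

Section UltraLimits.
Context {R : realType} {T : Type} (dist : T -> T -> \bar R) (Y : set T).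

(** The sets of pairs at distance less than [e] form a base of a uniformity on [Y]: the second
    clause yields both symmetry and the triangle inequality up to a modulus. *)
Definition weak_metric :=
  (forall x (e : R), Y x -> 0 < e -> (dist x x < e%:E)%E) /\
  (forall e : R, 0 < e -> exists2 c : R, 0 < c & forall x y z, Y x -> Y y -> Y z ->
     (dist x z < c%:E)%E -> (dist y z < c%:E)%E -> (dist x y < e%:E)%E).

Definition ultralimit {J : Type} (G : set_system J) (s : J -> T) (y : T) :=
  forall e : R, 0 < e -> G [set j | (dist y (s j) < e%:E)%E].

(** The family lives in [S] while its limit is sought in all of [Y]: this tests the compactness of
    the closure without mentioning the closure. *)
Definition ultraconvergent (S : set T) :=
  forall (J : Type) (G : set_system J) (s : J -> T), UltraFilter G ->
    G [set j | S (s j)] -> exists2 y, Y y & ultralimit G s y.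

Hypothesis Dw : weak_metric.

Lemma weak_metric_sym (e : R) : 0 < e -> exists2 c : R, 0 < c & forall x y, Y x -> Y y ->
  (dist x y < c%:E)%E -> (dist y x < e%:E)%E.
Proof.
move=> e0; have [c c0 H] := Dw.2 _ e0; exists c => // x y Yx Yy xy.
by apply: (H y x y) => //; apply: Dw.1.
Qed.

Lemma weak_metric_trans (e : R) : 0 < e -> exists2 c : R, 0 < c & forall x y z, Y x -> Y y -> Y z ->
  (dist x y < c%:E)%E -> (dist y z < c%:E)%E -> (dist x z < e%:E)%E.
Proof.
move=> e0; have [c c0 H] := Dw.2 _ e0; have [c' c'0 H'] := weak_metric_sym c0.
exists (Num.min c c'); first by rewrite lt_min c0.
move=> x y z Yx Yy Yz xy yz; apply: (H x z y) => //.
  by rewrite (lt_le_trans xy)// lee_fin ge_min lexx.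
by apply: H' => //; rewrite (lt_le_trans yz)// lee_fin ge_min lexx orbT.
Qed.

Lemma ultra_bigcup {J I : Type} (G : set_system J) (B : I -> set J) (F : set I) :
  UltraFilter G -> finite_set F -> G (\bigcup_(i in F) B i) -> exists2 i, F i & G (B i).
Proof.
move=> GU finF.
have /finite_seqP[s ->] : finite_set (F : set {classic I}) by [].
elim: s => [|a s IH].
  by rewrite set_nil bigcup_set0 => /filter_not_empty.
have [Ga _|Gna] := in_ultra_setVsetC (B a) GU.
  by exists a => //=; rewrite mem_head.
move=> H; have [|i si Gi] := IH.
  apply: filterS (filterI H Gna) => j [[i /=]].
  by rewrite inE => /orP[/eqP->//|si] Bi _; exists i.
by exists i => //=; rewrite inE si orbT.
Qed.

Lemma rel_compact_ultraP (S : set T) : S `<=` Y ->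
  rel_compact_in dist Y S <-> ultraconvergent S.
Proof.
move=> SY; split=> [[_ K] J G s GU Gs|US].
- apply: contrapT => nlim.
  (* Without an exact triangle inequality balls need not be open, so the cover consists of
     interiors: [U B] collects the points having a whole ball in which the members of the family
     have index in [B]. If no point is a limit, these sets with [B] outside [G] cover the closure,
     and a finite subcover puts a finite union of such [B] into [G]. *)
  pose U (B : {B : set J | ~ G B}) := [set z | Y z /\
    exists2 e : R, 0 < e & forall j, S (s j) -> (dist z (s j) < e%:E)%E -> sval B j].
  have [||F finF KF] := K _ U.
  + move=> B; split=> [z []//|z [Yz [e e0 zB]]].
    have [c c0 cH] := weak_metric_trans e0.
    exists c => // z' [Yz' zz']; split=> //; exists c => // j Sj z'j.
    by apply: zB => //; apply: (cH z z') => //; exact: SY.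
  + move=> y [Yy _]; apply: contrapT => nU; apply: nlim; exists y => // e e0.
    apply: contrapT => nG; apply: nU.
    exists (exist (fun B => ~ G B) _ nG) => //; split=> //; exists e => //.
  + have : G (\bigcup_(B in F) sval B).
      apply: filterS Gs => j /= Sj.
      have [|B FB [_ [e e0 BH]]] := KF (s j).
        split=> [|e e0]; first exact: SY.
        by exists (s j) => //; apply: Dw.1 => //; exact: SY.
      by exists B => //; apply: BH => //; apply: Dw.1 => //; exact: SY.
    by move=> /(ultra_bigcup GU finF)[[B nB] _ /=].
- split=> [x []//|I U Uo KU]; apply: contrapT => nF.
  (* An index is a point of the closure with a precision. Since [US] only concerns families in [S],
     the point is replaced by a point of [S] that close to it. *)
  pose K := closure_in dist Y S; pose J := (T * R)%type.
  have /choice[s sP] : forall j : J, exists y, K j.1 -> 0 < j.2 ->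
      S y /\ (dist j.1 y < j.2%:E)%E.
    case=> x e /=; have [[Kx e0]|nK] := pselect (K x /\ 0 < e).
      by have [y Sy xy] := Kx.2 _ e0; exists y.
    by exists x => Kx e0; case: nK.
  (* These sets generate a proper filter exactly because no finite subfamily covers: some point of
     the closure escapes any finite [D.1]. *)
  pose B (D : set I * R) : set J := [set j | [/\ K j.1, 0 < j.2, j.2 < D.2 &
    forall i, D.1 i -> ~ U i j.1]].
  have FP : ProperFilter (filter_from [set D : set I * R | finite_set D.1 /\ 0 < D.2] B).
    apply: filter_from_proper; last first.
      move=> [F e] /= [finF e0]; apply: contrapT => nB; apply: nF; exists F => // x Kx.
      apply: contrapT => nU; apply: nB; exists (x, e / 2); split=> //=.
      - by rewrite divr_gt0.
      - by rewrite ltr_pdivrMr// ltr_pMr// ltr1n.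
      - by move=> i Fi Ui; apply: nU; exists i.
    apply: filter_from_filter; first by exists (set0, 1).
    move=> [F1 e1] [F2 e2] /= [f1 e10] [f2 e20].
    exists (F1 `|` F2, Num.min e1 e2); first by rewrite /= finite_setU lt_min e10 e20.
    move=> [x e] /= [Kx e0]; rewrite /= lt_min => /andP[? ?] H.
    by split; split=> //= i Fi; apply: H; [left|right].
  have [G [GU FG]] := ultraFilterLemma FP.
  have GB (F : set I) e : finite_set F -> 0 < e -> G (B (F, e)).
    by move=> fF e0; apply: FG; exists (F, e).
  have [|y Yy ylim] := US J G s GU.
    apply: filterS (GB set0 1 (finite_set0 _) ltr01) => -[x e] [Kx e0 _ _].
    by have [] := sP (x, e) Kx e0.
  have Ky : K y.
    split=> // e e0.
    have [[x e'] [/= [Kx e'0 _ _] ye]] :=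
      filter_ex (filterI (GB set0 1 (finite_set0 _) ltr01) (ylim _ e0)).
    by exists (s (x, e')) => //; have [] := sP (x, e') Kx e'0.
  have [i _ Ui] := KU _ Ky.
  have [_ /(_ _ Ui)[e e0 ballU]] := Uo i.
  (* The limit [y] and the uncovered point are both within [c] of the same point of [S], hence the
     uncovered point falls into the ball around [y] inside [U i]. *)
  have [c c0 cH] := Dw.2 _ e0.
  have [[x e'] [/= [Kx e'0 e'c nU] ye]] :=
    filter_ex (filterI (GB [set i] c (finite_set1 _) c0) (ylim _ c0)).
  have [/= Sx xs] := sP (x, e') Kx e'0.
  apply: (nU i) => //; apply: ballU; split; first by case: Kx.
  apply: cH ye _ => //; [by case: Kx|exact: SY|].
  by rewrite (lt_trans xs)// lte_fin.
Qed.

End UltraLimits.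

(** Turns a sequence of counterexamples into a family with an ultralimit. *)
Lemma ultra_eventually : exists2 G : set_system nat, UltraFilter G & forall n, G [set m | (n <= m)%N].
Proof.
have [G [GU sub]] := ultraFilterLemma (@eventually_filter).
by exists G => // n; apply: sub; exists n.
Qed.

Lemma filter_seq {J : Type} {K : eqType} (G : set_system J) (s : seq K) (P : K -> set J) :
  Filter G -> (forall k, k \in s -> G (P k)) -> G [set j | forall k, k \in s -> P k j].
Proof.
move=> GF; elim: s => [|a s IH] H; first by apply: filterS filterT.
apply: filterS (filterI (H a (mem_head _ _)) (IH _)) => [j [aj sj] k|k ks].
  by rewrite inE => /orP[/eqP->//|/sj].
by apply: H; rewrite inE ks orbT.
Qed.

(** * Norms of countable families *)

Section Small.
Context {R : realType}.
Implicit Types (q : option R) (p e c : R) (I J : set nat) (f g : nat -> \bar R).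

Lemma esum_subset {T : choiceType} (P Q : set T) (a : T -> \bar R) :
  P `<=` Q -> (forall i, Q i -> 0 <= a i)%E -> (\esum_(i in P) a i <= \esum_(i in Q) a i)%E.
Proof.
move=> PQ a0; rewrite [leRHS](esumID P)//.
have -> : Q `&` P = P by apply/setIidPr.
by rewrite leeDl// esum_ge0// => i [/a0].
Qed.

Lemma poweR_le (x y : \bar R) p : 0 <= p -> (0 <= x)%E -> (x <= y)%E -> (poweR x p <= poweR y p)%E.
Proof.
move=> p0 x0 xy; apply: gt0_ler_poweR => //; rewrite in_itv /= leey andbT//.
exact: le_trans xy.
Qed.

Lemma powR_double p e : 1 <= p -> 0 <= e -> 2 * e `^ p <= (2 * e) `^ p.
Proof.
move=> p1 e0; rewrite powRM// ler_wpM2r ?powR_ge0//.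
by rewrite -[leLHS]powRr1// ler_powR// ler1n.
Qed.

Definition is_exponent q := if q is Some p then 1 <= p else true.

(* [l^q] norm of the family [f] on [I] at most [e]; [None] encodes [q = oo]. *)
Definition small q I f e : Prop := (forall i, I i -> 0 <= f i)%E /\
  if q is Some p then (\esum_(i in I) poweR (f i) p <= (e `^ p)%:E)%E
  else forall i, I i -> (f i <= e%:E)%E.

(** The nonzero terms of [f] embed injectively, through a chosen [M]-partner, into larger terms of
    [g]; zero terms need no partner. Almost all later comparisons of norms are instances. *)
Lemma small_reindex q I J f g e (M : nat -> nat -> Prop) : is_exponent q ->
  (forall i i' j, I i -> I i' -> M i j -> M i' j -> i = i') ->
  (forall i, I i -> (0 <= f i)%E /\
     (f i = 0%E \/ exists j, [/\ J j, M i j & (f i <= g j)%E])) ->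
  0 <= e -> small q J g e -> small q I f e.
Proof.
move=> qe Minj H e0 [g0 Jg]; split=> [i /H[]//|]; case: q qe Jg => [p p1 Jg|_ Jg]; last first.
  by move=> i /H[_ [->//|[j [/Jg + _ +]]]]; move=> /[swap]; exact: le_trans.
have p0 : 0 <= p by rewrite (le_trans _ p1).
have pn0 : p != 0 by rewrite gt_eqF// (lt_le_trans _ p1).
pose B := [set i | f i != 0%E].
rewrite (esumID B) => [|i _]; last exact: poweR_ge0.
rewrite [X in (_ + X)%E]esum1 ?adde0; last first.
  by move=> i [_ /negP/negPn/eqP->]; rewrite poweR0r.
have /choice[psi psiP] : forall i, exists j, (I `&` B) i -> [/\ J j, M i j & (f i <= g j)%E].
  move=> i; have [[Ii Bi]|n] := pselect ((I `&` B) i); last by exists 0%N.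
  have [_ [/eqP fi|[j ?]]] := H _ Ii; last by exists j.
  by move: Bi; rewrite /B /= fi.
apply: le_trans Jg; apply: (@le_trans _ _ (\esum_(i in I `&` B) poweR (g (psi i)) p)%E).
  apply: le_esum => i IBi; have [_ _ fg] := psiP _ IBi.
  by apply: poweR_le => //; have [] := H _ IBi.1.
rewrite -(@esum_image _ _ _ _ psi (fun j => poweR (g j) p)).
  apply: esum_subset => [_ [i /psiP[? _ _] <-]//|i _]; exact: poweR_ge0.
move=> i i' /set_mem IBi /set_mem IBi' eqpsi.
have [[_ Mi _] [_ Mi' _]] := (psiP _ IBi, psiP _ IBi').
by apply: Minj Mi _ => //; [exact: IBi.1|exact: IBi'.1|rewrite eqpsi].
Qed.

Lemma small_le q I J f g e : is_exponent q -> 0 <= e -> I `<=` J ->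
  (forall i, I i -> (0 <= f i)%E /\ (f i <= g i)%E) -> small q J g e -> small q I f e.
Proof.
move=> qe e0 IJ fg; apply: (@small_reindex _ _ _ _ _ _ eq) => //.
  by move=> i i' j _ _ -> ->.
by move=> i Ii; have [? ?] := fg i Ii; split=> //; right; exists i; split=> //; exact: IJ.
Qed.

Lemma small_leb q I f e e' : is_exponent q -> 0 <= e -> e <= e' -> small q I f e -> small q I f e'.
Proof.
case: q => [p|] qe e0 ee' [f0 H]; split=> //.
  apply: (le_trans H); rewrite lee_fin; apply: ge0_ler_powR => //.
  - by rewrite (le_trans _ qe).
  - by rewrite nnegrE (le_trans e0).
by move=> i /H/le_trans; apply; rewrite lee_fin.
Qed.

Lemma small_pt q I f e i : is_exponent q -> 0 <= e -> small q I f e -> I i -> (f i <= e%:E)%E.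
Proof.
case: q => [p|] qe e0 [f0 H] Ii; last exact: H.
have p0 : 0 < p by rewrite (lt_le_trans _ qe).
have : (poweR (f i) p <= (e `^ p)%:E)%E.
  apply: le_trans H; rewrite -(@esum_set1 _ _ i (fun i => poweR (f i) p)) ?poweR_ge0//.
  by apply: esum_subset => [j ->//|j _]; exact: poweR_ge0.
have := f0 _ Ii; case: (f i) => [x| |]//; last by rewrite poweRyr ?gt_eqF.
rewrite !lee_fin => x0; apply: contra_le => ex.
by rewrite gt0_ltr_powR// nnegrE.
Qed.

Lemma small_scale q I f g e c : is_exponent q -> 0 <= e -> 0 <= c ->
  (forall i, I i -> (0 <= g i)%E /\ (g i <= c%:E * f i)%E) -> small q I f e -> small q I g (c * e).
Proof.
move=> qe e0 c0 gf [f0 H]; split=> [i /gf[]//|]; case: q qe H => [p p1 H|_ H].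
  rewrite powRM// EFinM (@le_trans _ _ (\esum_(i in I) ((c `^ p)%:E * poweR (f i) p))%E)//.
    apply: le_esum => i Ii; have [g0 gfi] := gf _ Ii.
    rewrite -poweR_EFin -poweRM ?lee_fin ?f0//; apply: poweR_le => //.
    by rewrite (le_trans _ p1).
  rewrite /esum; apply: ub_ereal_sup => _ [F [finF FI] <-].
  rewrite -ge0_mule_fsumr; last by move=> i; exact: poweR_ge0.
  rewrite lee_wpmul2l ?lee_fin ?powR_ge0//.
  by apply: le_trans H; apply: ereal_sup_ubound; exists F.
move=> i Ii; have [_ /le_trans->//] := gf _ Ii.
by rewrite EFinM lee_wpmul2l ?lee_fin// H.
Qed.

Lemma small_union q I J f e : is_exponent q -> 0 <= e ->
  small q I f e -> small q J f e -> small q (I `|` J) f (2 * e).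
Proof.
move=> qe e0 [f0 If] [f0' Jf]; split=> [i [/f0|/f0']//|]; case: q qe If Jf => [p|] qe If Jf; last first.
  have e2 : (e%:E <= (2 * e)%:E)%E by rewrite lee_fin ler_peMl// ler1n.
  by move=> i [/If|/Jf] /le_trans; apply.
rewrite (esumID I) => [|i _]; last exact: poweR_ge0.
rewrite (@le_trans _ _ ((e `^ p)%:E + (e `^ p)%:E)%E)//; last first.
  by rewrite -EFinD lee_fin (le_trans _ (powR_double qe e0))// mulr2n mulrDl mul1r.
apply: leeD; [apply: le_trans If|apply: le_trans Jf]; apply: esum_subset => [i|i _]; rewrite ?poweR_ge0//.
  by case.
by case=> -[].
Qed.

(** A crude replacement of Minkowski: split [I] according to which of [f], [g] is larger, where the
    sum is at most twice the larger one; the union of the two parts costs another factor 2. *)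
Lemma small_add q I f g e : is_exponent q -> 0 <= e ->
  small q I f e -> small q I g e -> small q I (fun i => f i + g i)%E (4 * e).
Proof.
move=> qe e0 If Ig; have [If0 Ig0] := (If.1, Ig.1).
have -> : 4 * e = 2 * (2 * e) by rewrite mulrA -natrM.
have -> : I = (I `&` [set i | (g i <= f i)%E]) `|` (I `&` [set i | (f i <= g i)%E]).
  rewrite -setIUr; apply/esym/setIidPl => i Ii /=.
  by have [|/ltW] := leP (g i) (f i); [left|right].
apply: small_union => //; first by rewrite mulr_ge0.
  apply: (@small_scale _ _ f) => //; last by apply: small_le If => // i [Ii _]; rewrite If0.
  move=> i [Ii gf]; rewrite adde_ge0 ?If0 ?Ig0//; split=> //.
  rewrite (_ : 2%:E * f i = f i + f i)%E ?leeD2l//.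
  by rewrite -mule2n mule_natl.
apply: (@small_scale _ _ g) => //; last by apply: small_le Ig => // i [Ii _]; rewrite Ig0.
move=> i [Ii gf]; rewrite adde_ge0 ?If0 ?Ig0//; split=> //.
rewrite (_ : 2%:E * g i = g i + g i)%E ?leeD2r//.
by rewrite -mule2n mule_natl.
Qed.

(** The tolerance [eta] depends on the list alone and can be fixed before the family; half of [e] is
    spent on the head and half on the rest. *)
Lemma small_finite q (s : seq nat) e : is_exponent q -> 0 < e ->
  exists2 eta : R, 0 < eta & forall I f, I `<=` [set` s] ->
    (forall i, I i -> (0 <= f i)%E /\ (f i <= eta%:E)%E) -> small q I f e.
Proof.
move=> qe; elim: s e => [|a s IH] e e0.
  exists 1 => // I f; rewrite set_nil subset0 => -> _; split=> //.
  by case: q qe => // p _; rewrite esum_set0 lee_fin powR_ge0.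
have e20 : 0 < e / 2 by rewrite divr_gt0.
have [eta eta0 H] := IH _ e20.
exists (Num.min eta (e / 2)) => [|I f Is fe]; first by rewrite lt_min eta0.
have -> : I = (I `&` [set a]) `|` (I `&` ~` [set a]) by rewrite -setIUr setUv setIT.
have -> : e = 2 * (e / 2) by rewrite mulrCA divff ?mulr1.
have fe2 i : I i -> (f i <= (e/2)%:E)%E.
  by move=> /fe[_ /le_trans]; apply; rewrite lee_fin ge_min lexx orbT.
apply: small_union => //; first exact: ltW.
  split=> [i [/fe[]]//|]; case: q qe {IH H} => [p p1|_]; last by move=> i [/fe2].
  have p0 : 0 <= p by rewrite (le_trans _ p1).
  have [Ia|nIa] := pselect (I a).
    rewrite (_ : _ `&` _ = [set a]); last by apply/setIidPr => i ->.
    rewrite esum_set1 ?poweR_ge0// -poweR_EFin; apply: poweR_le => //.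
      by have [] := fe _ Ia.
    exact: fe2.
  rewrite (_ : _ `&` _ = set0) ?esum_set0 ?lee_fin ?powR_ge0//.
  by rewrite -subset0 => i [] /[swap] ->.
apply: H => [i [/Is /=]|i [/fe[? fi] _]].
  by rewrite inE => /orP[/eqP->//|].
by split=> //; apply: le_trans fi _; rewrite lee_fin ge_min lexx.
Qed.

(** The norm is the supremum over finite subfamilies, which is what lets a bound pass to a limit
    taken over finitely many indices at a time. *)
Lemma small_seq q I f e : (forall i, I i -> 0 <= f i)%E ->
  (forall s : seq nat, (forall i, i \in s -> I i) -> small q [set` s] f e) -> small q I f e.
Proof.
move=> f0 H; split=> //; case: q H => [p|] H; last first.
  move=> i Ii; have [|_ /(_ i)] := H [:: i]; first by move=> j /[!inE] /eqP->.
  by rewrite /= mem_head; exact.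
apply: ub_ereal_sup => _ [F [finF FI] <-].
have /finite_seqP[s Fs] := finF.
have [|_] := H s; first by move=> i si; apply: FI; rewrite Fs.
by rewrite -Fs -esum_fset// => i _; exact: poweR_ge0.
Qed.

End Small.

(** * Distance to the closed set [A] *)

Section DistanceToSet.
Context {R : realType} {X : Type} (d : X -> X -> \bar R) (A : set X).
Hypothesis dA : metric_pair d A.
Notation dA_ := (dist_set d A).

Lemma ext_metric_ge0 x y : (0 <= d x y)%E. Proof. exact: dA.1.1. Qed.
Lemma ext_metric_xx x : d x x = 0%E. Proof. exact: dA.1.2.1. Qed.
Lemma ext_metric_sym x y : d x y = d y x. Proof. exact: dA.1.2.2.1. Qed.
Lemma ext_metric_triangle y x z : (d x z <= d x y + d y z)%E. Proof. exact: dA.1.2.2.2. Qed.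

Lemma dist_set_ge0 x : (0 <= dA_ x)%E.
Proof. by apply: le_ereal_inf_tmp => _ [a _ <-]; exact: ext_metric_ge0. Qed.

Lemma dist_set_le x a : A a -> (dA_ x <= d x a)%E.
Proof. by move=> Aa; apply: ereal_inf_lbound; exists a. Qed.

Lemma dist_set_triangle x y : (dA_ x <= d x y + dA_ y)%E.
Proof.
have [dy|dy] := ltP (dA_ y) +oo%E; last first.
  by move: dy; rewrite leye_eq => /eqP->; rewrite addey ?leey// -ltNye (lt_le_trans _ (ext_metric_ge0 _ _)).
apply/lee_addgt0Pr => e e0.
have [_ [a Aa <-] ya] : exists2 z, [set d y a | a in A] z & (z < dA_ y + e%:E)%E.
  apply: ereal_inf_lt; rewrite lteDl ?lte_fin//.
  by rewrite ge0_fin_numE// dist_set_ge0.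
rewrite (le_trans (dist_set_le x Aa))// (le_trans (ext_metric_triangle y _ _))//.
by rewrite -addeA leeD2l// ltW.
Qed.

(** A point at distance 0 would belong to the closure of [A]; this is where closedness enters. *)
Lemma dist_set_gt0 x : ~ A x -> (0 < dA_ x)%E.
Proof.
move=> nAx; rewrite lt_neqAle dist_set_ge0 andbT; apply/eqP => x0; apply: nAx.
apply: dA.2; split=> // e e0.
have [_ [a Aa <-] xa] : exists2 z, [set d x a | a in A] z & (z < e%:E)%E.
  by apply: ereal_inf_lt; rewrite -[ereal_inf _]/(dA_ x) -x0 lte_fin.
by exists a.
Qed.

(** The infimum may not be attained, and a factor 2 leaves room only when the distance is positive
    and finite. Matchings need actual points of [A], obtained here. *)
Lemma dist_set_near x : ~ A x -> (dA_ x < +oo)%E ->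
  exists2 a, A a & (d x a <= 2%:E * dA_ x)%E.
Proof.
move=> nAx xoo; have x0 := dist_set_gt0 nAx.
have [_ [a Aa <-] xa] : exists2 z, [set d x a | a in A] z & (z < 2%:E * dA_ x)%E.
  apply: ereal_inf_lt; rewrite mule_natl mule2n lteDl//.
  by rewrite ge0_fin_numE// ltW.
by exists a => //; exact: ltW.
Qed.

End DistanceToSet.

(** * Couplings *)

Section Couplings.
Context {R : realType} {X : Type} (d : X -> X -> \bar R) (A : set X).
Hypothesis dA : metric_pair d A.
Notation dA_ := (dist_set d A).
Implicit Types (a b c : fsum X) (e : R) (q : option R).

(* A partial matching of the two sums, recorded by the displacement of every
   point: this symmetric form of a matching composes without Minkowski. *)
Record is_coupling a b (M : nat -> nat -> Prop) (f g : nat -> \bar R) : Prop := {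
  coupling_idx : forall i j, M i j -> idx a i /\ idx b j;
  coupling_inj : forall i i' j, M i j -> M i' j -> i = i';
  coupling_fun : forall i j j', M i j -> M i j' -> j = j';
  coupling_pair : forall i j, M i j ->
    (d (pt a i) (pt b j) <= f i)%E /\ (d (pt a i) (pt b j) <= g j)%E;
  coupling_left : forall i, idx a i -> (forall j, ~ M i j) -> (dA_ (pt a i) <= f i)%E;
  coupling_right : forall j, idx b j -> (forall i, ~ M i j) -> (dA_ (pt b j) <= g j)%E }.

Definition coupled q a b e := exists M f g,
  [/\ is_coupling a b M f g, small q (idx a) f e & small q (idx b) g e].

Lemma is_coupling_sym a b M f g : is_coupling a b M f g -> is_coupling b a (fun j i => M i j) g f.
Proof.
move=> C; split=> [i j /(coupling_idx C)[]//|i i' j|i j j'|i j|i|i].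
- exact: (coupling_fun C).
- exact: (coupling_inj C).
- by rewrite (ext_metric_sym dA) => /(coupling_pair C)[].
- exact: (coupling_right C).
- exact: (coupling_left C).
Qed.

Lemma coupled_sym q a b e : coupled q a b e -> coupled q b a e.
Proof. by move=> [M [f [g [C ? ?]]]]; exists (fun j i => M i j), g, f; split=> //; exact: is_coupling_sym. Qed.

(** Pull [h] back to [a] along [M], with value 0 at unmatched indices, and add it to [f].
    Injectivity of [M] keeps the pullback small, and the factor 4 is that of [small_add]. *)
Lemma coupling_bound_comp q a c M f g h e : is_exponent q -> 0 <= e ->
  is_coupling a c M f g -> small q (idx a) f e -> small q (idx c) h e ->
  exists2 f', small q (idx a) f' (4 * e) &
    (forall i, idx a i -> (f i <= f' i)%E) /\ (forall i k, M i k -> (f i + h k <= f' i)%E).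
Proof.
move=> qe e0 C sf sh.
have /choice[m mP] : forall i, exists k, forall k', M i k' -> M i k.
  move=> i; have [[k Mik]|n] := pselect (exists k, M i k); first by exists k.
  by exists 0%N => k Mik; case: n; exists k.
pose w i : \bar R := if `[<M i (m i)>] then h (m i) else 0%E.
have w0 i : (0 <= w i)%E.
  by rewrite /w; case: asboolP => // /(coupling_idx C)[_ /sh.1].
have sw : small q (idx a) w e.
  apply: (small_reindex (M := M)) sh => // [i i' j _ _|i ai]; first exact: (coupling_inj C).
  split=> //; rewrite /w; case: asboolP => [Mi|_]; last by left.
  by right; exists (m i); split=> //; have [] := coupling_idx C Mi.
exists (fun i => f i + w i)%E; first exact: small_add.
split=> [i ai|i k Mik]; first by rewrite leeDl.
have Mi := mP _ _ Mik; rewrite /w; case: asboolP => // _.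
by rewrite (coupling_fun C Mik Mi).
Qed.

(** Compose through [c]. A point of [a] whose partner in [c] is unmatched in the second coupling
    reaches [A] through that partner, so the same bound, displacement plus displacement of the
    partner, covers both matched and unmatched points. *)
Lemma coupled_trans q a b c e : is_exponent q -> 0 <= e ->
  coupled q a c e -> coupled q b c e -> coupled q a b (4 * e).
Proof.
move=> qe e0 [M1 [f1 [g1 [C1 sf1 sg1]]]] [M2 [f2 [g2 [C2 sf2 sg2]]]].
have [f sf [ff1 fM]] := coupling_bound_comp qe e0 C1 sf1 sg2.
have [g sg [gf2 gM]] := coupling_bound_comp qe e0 C2 sf2 sg1.
exists (fun i j => exists2 k, M1 i k & M2 j k), f, g; split=> //.
have half a' b' M1' M2' f1' g1' f2' g2' f' : is_coupling a' c M1' f1' g1' ->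
    is_coupling b' c M2' f2' g2' -> (forall i, idx a' i -> (f1' i <= f' i)%E) ->
    (forall i k, M1' i k -> (f1' i + g2' k <= f' i)%E) ->
    (forall i j k, M1' i k -> M2' j k -> (d (pt a' i) (pt b' j) <= f' i)%E) /\
    (forall i, idx a' i -> (forall j k, M1' i k -> ~ M2' j k) -> (dA_ (pt a' i) <= f' i)%E).
  move=> C1' C2' H1 H2; split=> [i j k Mik Mjk|i ai nM].
    apply: le_trans (H2 i k Mik); apply: le_trans (ext_metric_triangle dA (pt c k) _ _) _.
    rewrite (ext_metric_sym dA (pt c k)); apply: leeD; first exact: (coupling_pair C1' Mik).1.
    exact: (coupling_pair C2' Mjk).2.
  have [[k Mik]|n] := pselect (exists k, M1' i k); last first.
    apply: le_trans (H1 _ ai); apply: (coupling_left C1') => // k Mik.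
    by apply: n; exists k.
  apply: le_trans (H2 i k Mik); apply: le_trans (dist_set_triangle dA _ (pt c k)) _.
  apply: leeD; first exact: (coupling_pair C1' Mik).1.
  apply: (coupling_right C2'); first by have [] := coupling_idx C1' Mik.
  by move=> j; exact: nM.
have [p1 l1] := half _ _ _ _ _ _ _ _ _ C1 C2 ff1 fM.
have [p2 l2] := half _ _ _ _ _ _ _ _ _ C2 C1 gf2 gM.
split.
- by move=> i j [k /(coupling_idx C1)[? _] /(coupling_idx C2)[? _]].
- move=> i i' j [k Mik Mjk] [k' Mik' Mjk'].
  by move: Mik'; rewrite -(coupling_fun C2 Mjk Mjk'); exact: (coupling_inj C1).
- move=> i j j' [k Mik Mjk] [k' Mik' Mjk'].
  by move: Mjk'; rewrite -(coupling_fun C1 Mik Mik'); exact: (coupling_inj C2).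
- move=> i j [k Mik Mjk]; split; first exact: p1 Mik Mjk.
  by rewrite (ext_metric_sym dA); exact: p2 Mjk Mik.
- by move=> i ai nM; apply: l1 => // j k Mik Mjk; apply: (nM j); exists k.
- by move=> i ai nM; apply: l2 => // j k Mik Mjk; apply: (nM j); exists k.
Qed.

Lemma coupled_refl q a e : is_exponent q -> 0 < e -> coupled q a a e.
Proof.
move=> qe e0.
have s0 : small q (idx a) (fun=> 0%E) e.
  apply: (@small_reindex _ _ _ set0 _ (fun=> 0%E) _ eq) => //.
  - by move=> i i' j _ _ -> ->.
  - by move=> i _; split=> //; left.
  - exact: ltW.
  - split=> //; case: q qe => // p _; rewrite esum_set0 lee_fin powR_ge0//.
exists (fun i j => idx a i /\ i = j), (fun=> 0%E), (fun=> 0%E); split=> //; split.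
- by move=> i j [ai <-].
- by move=> i i' j [_ ->] [_ ->].
- by move=> i j j' [_ <-] [_ <-].
- by move=> i j [_ <-]; rewrite (ext_metric_xx dA).
- by move=> i ai /(_ i) [].
- by move=> i ai /(_ i) [].
Qed.

End Couplings.

(** * Comparison of the distances [W] with couplings *)

Section Wasserstein.
Context {R : realType} {X : Type} (d : X -> X -> \bar R) (A : set X).
Hypothesis dA : metric_pair d A.
Notation dA_ := (dist_set d A).
Implicit Types (a b c : fsum X) (e : R) (q : option R).

Definition W q := if q is Some p then Wp d A p else Winf d A.

Lemma esum_powR_ge0 (I : set nat) (f : nat -> \bar R) (p : R) :
  (0 <= \esum_(i in I) poweR (f i) p)%E.
Proof. by apply: esum_ge0 => i _; exact: poweR_ge0. Qed.

Lemma poweRK (p e : R) (x : \bar R) : 1 <= p -> 0 <= e -> (0 <= x)%E ->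
  (poweR x p^-1 < e%:E)%E = (x < (e `^ p)%:E)%E.
Proof.
move=> p1 e0; have p0 : 0 < p by rewrite (lt_le_trans _ p1).
case: x => [x| |]// x0; last first.
  by rewrite poweRyr ?invr_eq0 ?gt_eqF// ltNge leey ltNge leey.
rewrite lee_fin in x0; rewrite poweR_EFin !lte_fin.
have mono := gt0_ltr_powR p0.
have xp : (x `^ p^-1) `^ p = x by rewrite -powRrM mulVf ?gt_eqF// powRr1.
rewrite -{2}xp; apply/idP/idP => H.
  by apply: mono; rewrite ?nnegrE ?powR_ge0.
rewrite ltNge; apply: contraTN H => H; rewrite -leNgt.
apply: ge0_ler_powR => //; [exact: ltW|].
by rewrite nnegrE powR_ge0.
Qed.

Lemma matching_coupled q a b e m : is_exponent q -> 0 < e -> is_matching A a b m ->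
  ((if q is Some p then pcost d p a b m else infcost d a b m) < e%:E)%E -> coupled d A q a b e.
Proof.
move=> qe e0 [Ka Kb phi_inj Az Aw] cost.
pose K := mK m; pose phi := mphi m.
have /choice[psi psiP] : forall j, exists k, (phi @` K) j -> K k /\ phi k = j.
  move=> j; have [[k Kk kj]|n] := pselect ((phi @` K) j); first by exists k.
  by exists 0%N => /n.
pose f i := if `[<K i>] then d (pt a i) (pt b (phi i)) else d (pt a i) (mz m i).
pose g j := if `[<(phi @` K) j>] then d (pt a (psi j)) (pt b j) else d (mw m j) (pt b j).
have fK i : K i -> f i = d (pt a i) (pt b (phi i)) by rewrite /f => /asboolP->.
have fnK i : ~ K i -> f i = d (pt a i) (mz m i) by rewrite /f; case: asboolP.
have gK j : (phi @` K) j -> g j = d (pt a (psi j)) (pt b j) by rewrite /g => /asboolP->.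
have gnK j : ~ (phi @` K) j -> g j = d (mw m j) (pt b j) by rewrite /g; case: asboolP.
have psiK k : K k -> psi (phi k) = k.
  by move=> Kk; have [|Kp /phi_inj->//] := psiP (phi k); exists k.
exists (fun i j => K i /\ phi i = j), f, g; split.
- split.
  + by move=> i j [Ki <-]; split; [exact: Ka|exact: Kb].
  + by move=> i i' j [Ki <-] [Ki' /esym]; exact: phi_inj.
  + by move=> i j j' [_ <-] [_ <-].
  + by move=> i j [Ki <-]; rewrite fK// gK ?psiK//; exists i.
  + move=> i ai nK; have nKi : ~ K i by move=> Ki; apply: (nK (phi i)).
    by rewrite fnK//; apply: dist_set_le; exact: Az.
  + move=> j bj nK; have nKj : ~ (phi @` K) j by case=> k Kk kj; apply: (nK k).
    by rewrite gnK// (ext_metric_sym dA); apply: dist_set_le; exact: Aw.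
- split=> [i _|]; first by rewrite /f; case: ifP => _; exact: (ext_metric_ge0 dA).
  case: q qe cost => [p|] qe cost; last first.
    move=> i ai; apply: le_trans (ltW cost); apply: ereal_sup_ubound.
    have [Ki|nKi] := pselect (K i); first by rewrite fK//; left; left; right; exists i.
    by rewrite fnK//; left; right; exists i.
  move: cost; rewrite /pcost (poweRK qe (ltW e0)); last by rewrite !adde_ge0// esum_powR_ge0.
  move=> /ltW; apply: le_trans.
  (* The matched sum and the sum over the unmatched points of [a] make up the sum of [f]; the sum
     over the unmatched points of [b] is dropped. *)
  rewrite (esumID K); last by move=> *; exact: poweR_ge0.
  rewrite (_ : idx a `&` K = K); last exact/setIidPr.
  rewrite -[leLHS]adde0; apply: leeD; last exact: esum_powR_ge0.
  apply: leeD; apply: le_esum => i; first by move=> /fK->.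
  by move=> [ai /fnK->].
- split=> [i _|]; first by rewrite /g; case: ifP => _; exact: (ext_metric_ge0 dA).
  case: q qe cost => [p|] qe cost; last first.
    move=> j bj; apply: le_trans (ltW cost); apply: ereal_sup_ubound.
    have [Kj|nKj] := pselect ((phi @` K) j); last by rewrite gnK//; right; exists j.
    rewrite gK//; left; left; right; exists (psi j); first exact: (psiP _ Kj).1.
    by congr (d _ (pt b _)); exact: (psiP _ Kj).2.
  move: cost; rewrite /pcost (poweRK qe (ltW e0)); last by rewrite !adde_ge0// esum_powR_ge0.
  move=> /ltW; apply: le_trans.
  rewrite (esumID (phi @` K)); last by move=> *; exact: poweR_ge0.
  rewrite (_ : idx b `&` phi @` K = phi @` K); last first.
    by apply/setIidPr => _ [k Kk <-]; exact: Kb.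
  rewrite esum_image; last first.
    by move=> k k' /set_mem Kk /set_mem Kk'; exact: phi_inj.
  apply: leeD; last by apply: le_esum => j [bj /gnK->].
  rewrite -[leLHS]adde0; apply: leeD; last exact: esum_powR_ge0.
  by apply: le_esum => k Kk; rewrite gK ?psiK//; exists k.
Qed.

Lemma coupled_of_W q a b e : is_exponent q -> 0 < e -> (W q a b < e%:E)%E -> coupled d A q a b e.
Proof.
move=> qe e0 /[dup] Wlt; case: q qe Wlt => [p|] qe _ /=.
  by move=> /ereal_inf_lt[_ [m mm <-] H]; exact: (@matching_coupled (Some p) _ _ _ m).
by move=> /ereal_inf_lt[_ [m mm <-] H]; exact: (@matching_coupled None _ _ _ m).
Qed.

Lemma W_lt_matching q a b e m : is_exponent q -> 0 < e -> is_matching A a b m ->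
  small q (mK m) (fun k => d (pt a k) (pt b (mphi m k))) (e / 4) ->
  small q (idx a `\` mK m) (fun i => d (pt a i) (mz m i)) (e / 4) ->
  small q (idx b `\` (mphi m @` mK m)) (fun j => d (mw m j) (pt b j)) (e / 4) ->
  (W q a b < e%:E)%E.
Proof.
move=> qe e0 mm [_ s1] [_ s2] [_ s3].
have e40 : 0 < e / 4 by rewrite divr_gt0.
case: q qe s1 s2 s3 => [p|] qe s1 s2 s3 /=.
  apply: (@le_lt_trans _ _ (pcost d p a b m)); first by apply: ereal_inf_lbound; exists m.
  rewrite /pcost (poweRK qe (ltW e0)); last by rewrite !adde_ge0// esum_powR_ge0.
  apply: le_lt_trans (leeD (leeD s1 s2) s3) _; rewrite -!EFinD lte_fin.
  (* Applying [powR_double] twice shows that [e] to the power [p] is at least 4 times the power of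
     [e / 4], whereas the cost has only three such terms: hence the strict inequality. *)
  have eE : e = 2 * (2 * (e / 4)) by field.
  have x0 : 0 < (e / 4) `^ p by rewrite powR_gt0.
  have h1 := powR_double qe (ltW e40).
  have e20 : 0 <= 2 * (e / 4) by rewrite mulr_ge0// ltW.
  have h2 := powR_double qe e20.
  rewrite -eE in h2; lra.
apply: (@le_lt_trans _ _ (infcost d a b m)); first by apply: ereal_inf_lbound; exists m.
apply: (@le_lt_trans _ _ (e / 4)%:E); last by rewrite lte_fin ltr_pdivrMr// ltr_pMr// ltr1n.
apply: ub_ereal_sup => _ [[[->|[k Kk <-]]|[i ai <-]]|[j bj <-]].
- by rewrite lee_fin ltW.
- exact: s1.
- exact: s2.
- exact: s3.
Qed.

(** The factor 8 is the 4 of [W_lt_matching] times the 2 lost in [dist_set_near] when unmatched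
    points are given actual partners in [A]. *)
Lemma W_of_coupled q a b e : is_exponent q -> 0 < e -> in_Dbar A a -> in_Dbar A b ->
  coupled d A q a b (e / 8) -> (W q a b < e%:E)%E.
Proof.
move=> qe e0 aD bD [M [f [g [C sf sg]]]].
have e80 : 0 < e / 8 by rewrite divr_gt0.
have e4 : e / 4 = 2 * (e / 8) by field.
have foo I h i : small q I h (e / 8) -> I i -> (h i < +oo)%E.
  by move=> sh Ii; apply: le_lt_trans (small_pt qe (ltW e80) sh Ii) (ltry _).
have /choice[phi phiP] : forall i, exists j, forall j', M i j' -> M i j.
  move=> i; have [[k Mik]|n] := pselect (exists k, M i k); first by exists k.
  by exists 0%N => k Mik; case: n; exists k.
have near c h (P : nat -> Prop) : in_Dbar A c -> small q (idx c) h (e / 8) ->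
    (forall i, idx c i -> P i -> (dA_ (pt c i) <= h i)%E) ->
    exists z : nat -> X, forall i, idx c i -> P i ->
      A (z i) /\ (d (pt c i) (z i) <= 2%:E * h i)%E.
  move=> cD sh H; suff /choice[z zP] : forall i, exists z, idx c i -> P i ->
      A z /\ (d (pt c i) z <= 2%:E * h i)%E by exists z.
  move=> i.
  have [[ci Pi]|n] := pselect (idx c i /\ P i); last first.
    by exists (pt c 0%N) => ci Pi; case: n.
  have di := H i ci Pi.
  have [z Az zi] := dist_set_near dA (cD i ci) (le_lt_trans di (foo _ _ _ sh ci)).
  exists z => _ _; split=> //; apply: le_trans zi _.
  by rewrite lee_wpmul2l.
have [z zP] := near a f (fun i => forall j, ~ M i j) aD sf (coupling_left C).
have [w wP] := near b g (fun j => forall i, ~ M i j) bD sg (coupling_right C).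
pose K := [set i | exists j, M i j].
have MK i : K i -> M i (phi i) by move=> [j /phiP].
have nK i : ~ K i -> forall j, ~ M i j by move=> nKi j Mij; apply: nKi; exists j.
have nphiK j : ~ (phi @` K) j -> forall i, ~ M i j.
  move=> nj i Mij; apply: nj; exists i; first by exists j.
  by apply: (coupling_fun C (MK i _) Mij); exists j.
apply: (@W_lt_matching _ _ _ _ (Matching K phi z w)) => //=.
- split=> /=.
  + by move=> i [j /(coupling_idx C)[]].
  + by move=> i /MK/(coupling_idx C)[].
  + by move=> i i' /MK Mi /MK Mi' E; rewrite -E in Mi'; exact: (coupling_inj C) Mi Mi'.
  + by move=> i ai /nK nM; have [] := zP i ai nM.
  + by move=> j bj /nphiK nM; have [] := wP j bj nM.
- apply: (@small_leb _ _ _ _ (e / 8)) => //; [exact: ltW|by rewrite e4; lra|].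
  apply: (small_le _ _ _ _ sf) => //; [exact: ltW|by move=> i /MK/(coupling_idx C)[]|].
  by move=> i /MK Mi; split; [exact: (ext_metric_ge0 dA)|exact: (coupling_pair C Mi).1].
- rewrite e4; apply: (@small_scale _ _ _ f) => //; [exact: ltW| |].
    by move=> i [ai /nK nM]; split; [exact: (ext_metric_ge0 dA)|]; have [] := zP i ai nM.
  apply: (small_le _ _ _ _ sf) => //; [exact: ltW|].
  by move=> i [/sf.1].
- rewrite e4; apply: (@small_scale _ _ _ g) => //; [exact: ltW| |].
    move=> i [ai /nphiK nM]; rewrite (ext_metric_sym dA).
    by split; [exact: (ext_metric_ge0 dA)|]; have [] := wP i ai nM.
  apply: (small_le _ _ _ _ sg) => //; [exact: ltW|].
  by move=> i [/sg.1].
Qed.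

Lemma W_weak_metric q : is_exponent q -> weak_metric (W q) (in_Dbar A).
Proof.
move=> qe; split=> [a e aD e0|e e0].
  by apply: W_of_coupled => //; apply: coupled_refl => //; rewrite divr_gt0.
have c0 : 0 < e / 32 by rewrite divr_gt0.
exists (e / 32) => // a b c aD bD cD ac bc.
apply: W_of_coupled => //; rewrite (_ : e / 8 = 4 * (e / 32)); last by field.
apply: coupled_trans (ltW c0) (coupled_of_W qe c0 ac) (coupled_of_W qe c0 bc) => //.
Qed.

Lemma weak_metric_sub {T : Type} (D : T -> T -> \bar R) (Y Y' : set T) :
  Y `<=` Y' -> weak_metric D Y' -> weak_metric D Y.
Proof.
move=> YY' [D0 Dt]; split=> [x e /YY'|e /Dt[c c0 H]]; first exact: D0.
by exists c => // x y z /YY' Yx /YY' Yy /YY' Yz; exact: H.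
Qed.

Lemma metric_weak_metric : weak_metric d setT.
Proof.
split=> [x e _ e0|e e0]; first by rewrite (ext_metric_xx dA) lte_fin.
exists (e / 2) => [|x y z _ _ _ xz yz]; first by rewrite divr_gt0.
apply: le_lt_trans (ext_metric_triangle dA z x y) _.
rewrite (ext_metric_sym dA z) [e]splitr EFinD.
by apply: lteD.
Qed.

End Wasserstein.

(** * Finite families and remainders of convergent series *)

Section FiniteFamilies.
Context {R : realType}.
Implicit Types (q : option R) (s : seq nat) (f : nat -> \bar R).

Lemma seq_pos_lbound s f : (forall i, i \in s -> 0 < f i)%E ->
  exists2 dl : R, 0 < dl & forall i, i \in s -> (dl%:E <= f i)%E.
Proof.
elim: s => [|a s IH] f0; first by exists 1.
have [|dl dl0 H] := IH; first by move=> i si; apply: f0; rewrite inE si orbT.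
have [r r0 rf] : exists2 r : R, 0 < r & (r%:E <= f a)%E.
  have := f0 a (mem_head _ _); case: (f a) => [r| |]// r0; first by exists r.
  by exists 1; rewrite ?leey.
exists (Num.min dl r) => [|i]; first by rewrite lt_min dl0.
rewrite inE => /orP[/eqP->|/H]; [move: rf|]; apply: le_trans; rewrite lee_fin ge_min lexx ?orbT//.
Qed.

Lemma seq_ubound s f : (forall i, i \in s -> f i < +oo)%E ->
  exists2 B : R, 0 < B & forall i, i \in s -> (f i <= B%:E)%E.
Proof.
elim: s => [|a s IH] foo; first by exists 1.
have [|B B0 H] := IH; first by move=> i si; apply: foo; rewrite inE si orbT.
have [r rf] : exists r : R, (f a <= r%:E)%E.
  have := foo a (mem_head _ _); case: (f a) => [r| |]// _; first by exists r.
  by exists 0; rewrite leNye.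
exists (Num.max B r) => [|i]; first by rewrite lt_max B0.
by rewrite inE => /orP[/eqP->|/H]; [move: rf|]; move/le_trans; apply; rewrite lee_fin le_max lexx ?orbT.
Qed.

Lemma small_finite_exists q s (I : set nat) f : is_exponent q -> I `<=` [set` s] ->
  (forall i, I i -> (0 <= f i)%E /\ (f i < +oo)%E) -> exists2 e : R, 0 < e & small q I f e.
Proof.
move=> qe Is f0.
have [eta eta0 H] := small_finite s qe ltr01.
(* The list may contain indices outside [I], where [f] is uncontrolled. With a bound [B] at hand,
   [f] is scaled down by [eta / B] to have norm at most 1, then scaled back. *)
pose g i : \bar R := if `[<I i>] then f i else 0%E.
have [|B B0 gB] := @seq_ubound s g.
  by move=> i _; rewrite /g; case: asboolP => [/f0[]|_]//; exact: ltry.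
have c0 : 0 < B / eta by rewrite divr_gt0.
exists (B / eta * 1); first by rewrite mulr1.
apply: (@small_scale _ _ _ (fun i => (eta / B)%:E * f i)%E) => //; first exact: ltW.
  move=> i /f0[fi _]; split=> //.
  by rewrite muleA -EFinM mulrA mulfVK ?gt_eqF// divff ?gt_eqF// mul1e.
apply: H => // i Ii; have [fi _] := f0 i Ii; split.
  by rewrite mule_ge0// lee_fin divr_ge0// ltW.
have := gB i (Is _ Ii); rewrite /g (asboolT Ii) => fB.
rewrite (@le_trans _ _ ((eta / B)%:E * B%:E)%E)//.
  by rewrite lee_wpmul2l// lee_fin divr_ge0// ltW.
by rewrite -EFinM mulfVK ?gt_eqF.
Qed.

(** A finite partial sum comes within the [p]-th power of [eta] of the finite total, so the
    remainder is at most that. This is specific to finite exponents. *)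
Lemma small_cofinite (p : R) (I : set nat) f e eta : 1 <= p -> 0 < eta ->
  small (Some p) I f e -> exists2 F : set nat, finite_set F /\ F `<=` I & small (Some p) (I `\` F) f eta.
Proof.
move=> p1 eta0 [f0 sI]; pose g i := poweR (f i) p.
have g0 i : (0 <= g i)%E by exact: poweR_ge0.
have s0 : (0 <= \esum_(i in I) g i)%E by exact: esum_ge0.
have sfin : (\esum_(i in I) g i)%E \is a fin_num.
  by rewrite ge0_fin_numE// (le_lt_trans sI)// ltry.
have : (\esum_(i in I) g i - (eta `^ p)%:E < \esum_(i in I) g i)%E.
  by rewrite lteBlDr// lteDl// lte_fin powR_gt0.
move=> /ereal_sup_gt[_ [F [finF FI] <-]] H; exists F => //; split=> [i []/f0//|].
suff : (\esum_(i in I `\` F) g i <= (eta `^ p)%:E)%E by [].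
move: H; rewrite -esum_fset// setDE.
rewrite (esumID F) in sfin *; last by move=> i _; exact: g0.
rewrite (_ : I `&` F = F) in sfin *; last exact/setIidPr.
set x := (\esum_(i in F) _)%E in sfin *; set y := (\esum_(i in _ `&` _) _)%E in sfin *.
have x0 : (0 <= x)%E by exact: esum_ge0.
have y0 : (0 <= y)%E by exact: esum_ge0.
move: sfin x0 y0; case: x => [x| |]//; case: y => [y| |]// _ _ _.
rewrite -EFinD -EFinB lte_fin lee_fin; lra.
Qed.

End FiniteFamilies.

(** * Tails *)

Section Tails.
Context {R : realType} {X : Type} (d : X -> X -> \bar R) (A : set X).
Hypothesis dA : metric_pair d A.
Notation dA_ := (dist_set d A).
Implicit Types (a b c : fsum X) (e : R) (q : option R) (dl : \bar R).

(** Up to a factor 8 this bounds the distance from [l_ d A dl a] to the empty sum: a matching with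
    the empty sum can only send each point to [A]. *)
Definition tail q a dl e :=
  small q (idx a `&` [set i | (dA_ (pt a i) < dl)%E]) (fun i => dA_ (pt a i)) e.

Lemma tail_of_W q a dl e : is_exponent q -> 0 < e -> in_Dbar A a ->
  (W d A q (l_ d A dl a) (fzero_like a) < e%:E)%E -> tail q a dl e.
Proof.
move=> qe e0 aD /(coupled_of_W dA qe e0)[M [f [g [C sf _]]]].
apply: small_le sf => //; first exact: ltW.
  by move=> i [ai idl]; split=> //; split=> //; exact: aD.
move=> i [ai idl]; split; first exact: (dist_set_ge0 dA).
apply: (coupling_left C) => [|j /(coupling_idx C)[]//].
by split=> //; split=> //; exact: aD.
Qed.

Lemma W_of_tail q a dl e : is_exponent q -> 0 < e -> in_Dbar A a ->
  tail q a dl (e / 8) -> (W d A q (l_ d A dl a) (fzero_like a) < e%:E)%E.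
Proof.
move=> qe e0 aD ta; have e80 : 0 < e / 8 by rewrite divr_gt0.
apply: (W_of_coupled dA) => //; first by move=> i [ai _]; exact: aD.
exists (fun _ _ => False), (fun i => dA_ (pt a i)), (fun=> 0%E); split.
- by split.
- apply: small_le ta => //; first exact: ltW.
    by move=> i [ai []].
  by move=> i _; rewrite (dist_set_ge0 dA).
- split=> //; case: q qe {ta} => // p _; by rewrite esum_set0 lee_fin powR_ge0.
Qed.

Definition in_D q : set (fsum X) := if q is Some p then in_Dp d A p else in_Dinf d A.

(** One description for both kinds of exponents. For the sup norm the tail clause holds with [dl]
    equal to [e]; for finite [p], finite total cost amounts to finite upper parts and vanishing
    tails. *)
Lemma in_DP q a : is_exponent q -> in_D q a <->
  [/\ in_Dbar A a, forall dl : R, 0 < dl -> finite_set (idx (u_ d A dl%:E a)) &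
      forall e : R, 0 < e -> exists2 dl : R, 0 < dl & tail q a dl%:E e].
Proof.
case: q => [p p1|_]; last first.
  split=> [[aD fa]|[]//]; split=> // e e0; exists e => //; split=> i [_ /ltW//].
  by move=> _; exact: (dist_set_ge0 dA).
split=> [[aD foo Wfin]|[aD fa ta]].
- have [r r0 Wr] : exists2 r : R, 0 < r & (W d A (Some p) (l_ d A +oo%E a) (fzero_like a) < r%:E)%E.
    move: Wfin; rewrite -[Wp d A p _ _]/(W d A (Some p) _ _).
    case: (W _ _ _ _ _) => [r| |]// _; last by exists 1; rewrite ?ltNyr.
    exists (Num.max 1 (r + 1)); first by rewrite lt_max ltr01.
    by rewrite lte_fin lt_max ltrDl ltr01 orbT.
  have too := tail_of_W p1 r0 aD Wr; split=> // e e0.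
    (* Outside [F] each finite distance to [A] is at most [e / 2], so a point at distance at least
       [e] lies in [F] or at infinite distance. *)
    have [F [finF FI] sF] := small_cofinite p1 (divr_gt0 e0 (ltr0n _ 2)) too.
    apply: (@sub_finite_set _ _ (F `|` idx (u_ d A +oo%E a))); last by rewrite finite_setU.
    move=> i [ai /= /negP]; rewrite -leNgt => ei.
    have [ioo|ioo] := ltP (dA_ (pt a i)) +oo%E; last first.
      by right; split=> //=; apply/negP; rewrite -leNgt.
    left; apply: contrapT => nFi.
    have e20 : 0 <= e / 2 by rewrite divr_ge0// ltW.
    have := small_pt (i := i) (p1 : is_exponent (Some p)) e20 sF.
    move=> /(_ (conj (conj ai ioo) nFi))/(le_trans ei).
    by rewrite lee_fin leNgt ltr_pdivrMr// ltr_pMr// ltr1n.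
  have [F [finF FI] sF] := small_cofinite p1 e0 too.
  have /finite_seqP[s Fs] := finF.
  (* Taking [dl] below the distances of the finitely many exceptional points removes them from the
     tail. *)
  have [|dl dl0 H] := @seq_pos_lbound R s (fun i => dA_ (pt a i)).
    move=> i si; apply: (dist_set_gt0 dA); apply: aD.
    by have [] : (idx a `&` [set i | (dA_ (pt a i) < +oo)%E]) i by apply: FI; rewrite Fs.
  exists dl => //; apply: small_le sF => //; first exact: ltW.
    move=> i [ai /= idl]; split; first by split=> //=; rewrite (lt_trans idl)// ltry.
    by rewrite Fs => /H; rewrite leNgt idl.
  by move=> i _; rewrite (dist_set_ge0 dA).
- split=> //.
    apply: sub_finite_set (fa 1 ltr01) => i [ai /= /negP]; rewrite -leNgt leye_eq => /eqP E.
    by split=> //=; rewrite E ltNge leey.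
  have [dl dl0] := ta 1 ltr01; rewrite /tail => tdl.
  have /finite_seqP[s us] := fa dl dl0.
  (* The points at finite distance are the tail below [dl] together with the finite set [J], each
     part having finite norm. *)
  pose J := idx (u_ d A dl%:E a) `&` [set i | (dA_ (pt a i) < +oo)%E].
  have [||e e0 sJ] := @small_finite_exists R (Some p) s J (fun i => dA_ (pt a i)) p1.
  + by rewrite -us => i [].
  + by move=> i [_]; split=> //; exact: (dist_set_ge0 dA).
  pose r := Num.max 1 e; have r0 : 0 < r by rewrite lt_max ltr01.
  have too : tail (Some p) a +oo%E (2 * r).
    have : small (Some p) ((idx a `&` [set i | (dA_ (pt a i) < dl%:E)%E]) `|` J)
        (fun i => dA_ (pt a i)) (2 * r).
      apply: small_union => //; first exact: ltW.
        by apply: small_leb tdl => //; rewrite le_max lexx.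
      by apply: small_leb sJ => //; [exact: ltW|rewrite le_max lexx orbT].
    apply: small_le => //; [by rewrite mulr_ge0// ltW| |].
      move=> i [ai /= ioo]; have [idl|idl] := ltP (dA_ (pt a i)) dl%:E; first by left.
      by right; split=> //; split=> //=; apply/negP; rewrite -leNgt.
    by move=> i _; rewrite (dist_set_ge0 dA).
  apply: (@lt_trans _ _ (8 * (2 * r))%:E); last exact: ltry.
  apply: (@W_of_tail (Some p)) => //; first by rewrite !mulr_gt0.
  by rewrite mulrC mulKf.
Qed.

End Tails.

Lemma lee_lt_addEFin {R : realType} (x y : \bar R) (e dl : R) :
  (x <= e%:E)%E -> (y < dl%:E)%E -> (x + y < (e + dl)%:E)%E.
Proof.
case: x y => [x| |] [y| |]//; rewrite ?ltNyr// lee_fin !lte_fin => ? ?.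
exact: ler_ltD.
Qed.

(** * Necessity *)

Section Necessity.
Context {R : realType} {X : Type} (d : X -> X -> \bar R) (A : set X).
Hypothesis dA : metric_pair d A.
Notation dA_ := (dist_set d A).
Implicit Types (a b c : fsum X) (e : R) (q : option R) (S : set (fsum X)).

Definition unif_vanishing q S := forall e, 0 < e ->
  exists2 dl : R, 0 < dl & forall a, S a -> tail d A q a dl%:E e.

Lemma unif_p_vanishingP (p : R) S : 1 <= p -> S `<=` in_Dp d A p ->
  unif_p_vanishing d A p S <-> unif_vanishing (Some p) S.
Proof.
move=> p1 SD; split=> V e e0.
  have [dl dl0 H] := V e e0; exists dl => // a Sa.
  by apply: (@tail_of_W _ _ _ _ dA (Some p)) (H a Sa) => //; have [] := SD a Sa.
have e80 : 0 < e / 8 by rewrite divr_gt0.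
have [dl dl0 H] := V _ e80; exists dl => // a Sa.
by apply: (@W_of_tail _ _ _ _ dA (Some p)) (H a Sa) => //; have [] := SD a Sa.
Qed.

(** An unmatched point of [b] would be within [e] of [A], less than [dl']; a matched one moves by at
    most [e], so its partner keeps distance at least [dl]. *)
Lemma coupling_partner q a b M f g e (dl dl' : R) i : is_exponent q -> 0 <= e ->
  is_coupling d A a b M f g -> small q (idx b) g e -> 0 < dl -> dl + e <= dl' ->
  idx (u_ d A dl'%:E b) i ->
  exists m, [/\ M m i, idx (u_ d A dl%:E a) m & (d (pt a m) (pt b i) <= e%:E)%E].
Proof.
move=> qe e0 C sg dl0 dle [bi /= /negP]; rewrite -leNgt => dli.
have gi := small_pt qe e0 sg bi.
have [[m Mmi]|nM] := pselect (exists m, M m i); last first.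
  have := le_trans dli (le_trans (coupling_right C bi _) gi).
  rewrite lee_fin => H; suff : dl' <= e by lra.
  by apply: H => m Mmi; apply: nM; exists m.
have de := le_trans (coupling_pair C Mmi).2 gi.
exists m; split=> //; split; first by have [] := coupling_idx C Mmi.
move=> /= dm; have := dist_set_triangle dA (pt b i) (pt a m).
rewrite (ext_metric_sym dA) => /(le_trans dli) H.
have : (dl'%:E < (e + dl)%:E)%E.
  by apply: le_lt_trans H _; exact: lee_lt_addEFin.
rewrite lte_fin; lra.
Qed.

(** Two tolerances are at work: [eta] bounds each single displacement and keeps partners of tail
    points below [dl'], while [e] bounds norms. The distance of a tail point is then at most its
    displacement plus the tail distance of its partner. *)
Lemma tail_coupled q a b eta e (dl dl' : R) : is_exponent q -> 0 <= eta -> eta <= e ->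
  coupled d A q b a eta -> tail d A q a dl'%:E e -> dl + eta <= dl' -> tail d A q b dl%:E (4 * e).
Proof.
move=> qe eta0 etae [M [f [g [C sf sg]]]] ta dle; have e0 := le_trans eta0 etae.
(* Cutting off at [dl'] makes the tail of [a] a family that is small on the whole index set. *)
pose h i : \bar R := if (dA_ (pt a i) < dl'%:E)%E then dA_ (pt a i) else 0%E.
have sh : small q (idx a) h e.
  apply: (small_reindex (M := eq)) ta => // [i i' j _ _ -> ->//|i ai].
  rewrite /h; case: ifPn => [idl|_]; last by split=> //; left.
  split; first exact: (dist_set_ge0 dA).
  by right; exists i; split.
have [f' sf' [ff' hf']] := coupling_bound_comp qe e0 C (small_leb qe eta0 etae sf) sh.
apply: small_le sf' => //; [by rewrite mulr_ge0|].
move=> i [bi /= idl]; split; first exact: (dist_set_ge0 dA).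
have [[k Mik]|nM] := pselect (exists k, M i k); last first.
  apply: le_trans (ff' i bi); apply: (coupling_left C) => // k Mik.
  by apply: nM; exists k.
have dik := le_trans (coupling_pair C Mik).1 (small_pt qe eta0 sf bi).
have dk : (dA_ (pt a k) < dl'%:E)%E.
  apply: le_lt_trans (dist_set_triangle dA _ (pt b i)) _.
  rewrite (ext_metric_sym dA); apply: (@lt_le_trans _ _ (eta + dl)%:E); first exact: lee_lt_addEFin.
  by rewrite lee_fin addrC.
apply: le_trans (hf' _ _ Mik); apply: le_trans (dist_set_triangle dA _ (pt a k)) _.
by rewrite /h dk leeD// (coupling_pair C Mik).1.
Qed.

Variables (q : option R) (S : set (fsum X)).
Hypotheses (qe : is_exponent q) (SD : S `<=` in_D d A q).
Hypothesis Sconv : ultraconvergent (W d A q) (in_D d A q) S.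

Lemma ultralimit_coupled {J : Type} (G : set_system J) (s : J -> fsum X) a e : Filter G ->
  ultralimit (W d A q) G s a -> 0 < e -> G [set j | coupled d A q a (s j) e].
Proof. by move=> FG lim e0; apply: filterS (lim e e0) => j; exact: (coupled_of_W dA). Qed.

(** Along a sequence with unbounded counts, a sum close to the limit [a] has all its points at
    distance [eps] among the partners of the finitely many points of [a] at distance [eps / 2],
    which bounds the count by [size t]. *)
Lemma ultraconvergent_unif_upper_finite : unif_upper_finite d A S.
Proof.
move=> eps eps0; apply: contrapT => nM.
have /choice[s sP] : forall n : nat, exists a, S a /\ ~ Defs.card_le (idx (u_ d A eps%:E a)) (n%:R : R).
  move=> n; apply: contrapT => na; apply: nM; exists n%:R; split=> // a Sa.
  by apply: contrapT => nc; apply: na; exists a.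
have [G GU Gn] := ultra_eventually.
have [|a Da lim] := Sconv (s := s) GU; first by apply: filterS filterT => n _; exact: (sP n).1.
have /(in_DP dA _ qe)[aD fa _] := Da.
have e20 : 0 < eps / 2 by rewrite divr_gt0.
have e40 : 0 < eps / 4 by rewrite divr_gt0.
have /finite_seqP[t tE] := fa _ e20.
have [n [/= [M [f [g [C _ sg]]]] tn]] := filter_ex (filterI (ultralimit_coupled _ lim e40) (Gn (size t))).
apply: (sP n).2.
have /choice[psi psiP] : forall m, exists i, forall i', M m i' -> M m i.
  move=> m; have [[i Mi]|nm] := pselect (exists i, M m i); first by exists i.
  by exists 0%N => i Mi; case: nm; exists i.
exists (map psi t); first by rewrite size_map ler_nat.
move=> i ui; have [|m [Mmi um _]] := coupling_partner qe (ltW e40) C sg e20 _ ui; first by lra.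
rewrite /= (coupling_fun C Mmi (psiP _ _ Mmi)); apply: map_f.
by rewrite tE in um.
Qed.

Lemma ultraconvergent_upper_rel_compact : upper_rel_compact d A S.
Proof.
move=> eps eps0; apply/(rel_compact_ultraP (metric_weak_metric dA)) => //.
move=> J G x GU Gx.
have [j0 [a0 Sa0 _]] := filter_ex Gx.
have /choice[s sP] : forall j, exists ai : fsum X * nat,
    (\bigcup_(a in S) supp (u_ d A eps%:E a)) (x j) ->
    [/\ S ai.1, idx (u_ d A eps%:E ai.1) ai.2 & pt ai.1 ai.2 = x j].
  move=> j; have [[a Sa [i ui ix]]|n] := pselect ((\bigcup_(a in S) supp (u_ d A eps%:E a)) (x j)).
    by exists (a, i).
  by exists (a0, 0%N) => /n.
have [|a Da lim] := Sconv (s := fun j => (s j).1) GU.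
  by apply: filterS Gx => j /sP[].
have /(in_DP dA _ qe)[aD fa _] := Da.
have e20 : 0 < eps / 2 by rewrite divr_gt0.
have /finite_seqP[t tE] := fa _ e20.
apply: contrapT => nlim.
(* For each precision the ultrafilter selects some point of the list [t] close to [x j], but the
   selected point may depend on the precision. Assuming that no point of [a] is a limit, one
   precision below all the failing ones on [t] gives a contradiction. *)
have /choice[em emP] : forall m, exists e, 0 < e /\ ~ G [set j | (d (pt a m) (x j) < e%:E)%E].
  move=> m; apply: contrapT => nm; apply: nlim; exists (pt a m) => // e e0.
  by apply: contrapT => nG; apply: nm; exists e.
have [|e e0 eem] := @seq_pos_lbound R t (fun m => (em m)%:E).
  by move=> m _; rewrite lte_fin; exact: (emP m).1.
pose eta := Num.min (e / 2) (eps / 4).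
have eta0 : 0 < eta by rewrite lt_min !divr_gt0.
have etaeps : eps / 2 + eta <= eps.
  have : eta <= eps / 4 by rewrite ge_min lexx orbT.
  lra.
have etae : eta < e.
  by rewrite /eta gt_min ltr_pdivrMr// ltr_pMr// ltr1n.
have [m tm Gm] : exists2 m, [set` t] m & G [set j | (d (pt a m) (x j) <= eta%:E)%E].
  apply: (@ultra_bigcup _ _ G (fun m => [set j | (d (pt a m) (x j) <= eta%:E)%E]) [set` t] GU).
    exact: finite_seq.
  apply: filterS (filterI Gx (ultralimit_coupled _ lim eta0)) => j /=.
  move=> [/sP[Ss us xj] [M [f [g [C _ sg]]]]].
  have [m [_ um dm]] := coupling_partner qe (ltW eta0) C sg e20 etaeps us.
  by exists m; [rewrite -tE|rewrite /= -xj].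
apply: (emP m).2; apply: filterS Gm => j /= /le_lt_trans; apply.
by apply: lt_le_trans (eem m tm); rewrite lte_fin.
Qed.

Lemma ultraconvergent_unif_vanishing : unif_vanishing q S.
Proof.
move=> e e0; apply: contrapT => nV.
have /choice[s sP] : forall n : nat, exists a, S a /\ ~ tail d A q a (n.+1%:R^-1)%:E e.
  move=> n; apply: contrapT => na; apply: nV; exists n.+1%:R^-1; first by rewrite invr_gt0.
  by move=> a Sa; apply: contrapT => nt; apply: na; exists a.
have [G GU Gn] := ultra_eventually.
have [|a Da lim] := Sconv (s := s) GU; first by apply: filterS filterT => n _; exact: (sP n).1.
have /(in_DP dA _ qe)[aD _ ta] := Da.
have e40 : 0 < e / 4 by rewrite divr_gt0.
have [dl dl0] := ta _ e40; rewrite /tail => tdl.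
(* The threshold [dl] is shared equally between the displacement [eta] and the vanishing threshold
   of the [n]-th sum; [e / 4] absorbs the factor of [tail_coupled]. *)
pose eta := Num.min (e / 4) (dl / 2).
have eta0 : 0 < eta by rewrite lt_min !divr_gt0.
have [N] := @ltr_add_invr R 0 (dl / 2) (divr_gt0 dl0 (ltr0n _ 2)); rewrite add0r => Ndl.
have [n [/= can Nn]] := filter_ex (filterI (ultralimit_coupled _ lim eta0) (Gn N)).
apply: (sP n).2; rewrite (_ : e = 4 * (e / 4)); last by field.
apply: tail_coupled (ltW eta0) _ (coupled_sym dA can) tdl _ => //; first by rewrite ge_min lexx.
rewrite [leRHS]splitr lerD//; last by rewrite ge_min lexx orbT.
by rewrite (le_trans _ (ltW Ndl))// lef_pV2 ?posrE// ler_nat.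
Qed.

End Necessity.

(** * Sufficiency *)

Section Sufficiency.
Context {R : realType} {X : Type} (d : X -> X -> \bar R) (A : set X).
Hypothesis dA : metric_pair d A.
Notation dA_ := (dist_set d A).

Definition scale (n : nat) : R := n.+1%:R^-1.

Lemma scale_gt0 n : 0 < scale n. Proof. by rewrite invr_gt0. Qed.

Lemma scale_lt (e : R) : 0 < e -> exists n, scale n < e.
Proof. by move=> e0; have [n] := @ltr_add_invr R 0 e e0; rewrite add0r; exists n. Qed.

(** Shells around [A]: level 0 holds the distances at least 1, including infinite ones, and
    minimality of [n] avoids a predecessor. *)
Definition level (n : nat) (x : X) :=
  ~ (dA_ x < (scale n)%:E)%E /\ forall n', (n' < n)%N -> (dA_ x < (scale n')%:E)%E.

Lemma level_exists x : (0 < dA_ x)%E -> exists n, level n x.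
Proof.
move=> x0; have exn : exists n, ~~ (dA_ x < (scale n)%:E)%E.
  (* The one-element list only serves to get a positive real below a possibly infinite distance. *)
  have [|e e0 ex] := @seq_pos_lbound R [:: 0%N] (fun=> dA_ x); first by [].
  have [n ne] := scale_lt e0; exists n; rewrite -leNgt (le_trans _ (ex 0%N _))//.
  by rewrite lee_fin ltW.
case: (ex_minnP exn) => k /negP kx kmin; exists k; split=> // n' n'k.
by apply: contraLR n'k => /kmin; rewrite -leqNgt.
Qed.

Lemma level_unique n n' x : level n x -> level n' x -> n = n'.
Proof.
by move=> [n1 n2] [n'1 n'2]; case: (ltngtP n n') => // [/n'2/n1|/n2/n'1].
Qed.

Variables (q : option R) (S : set (fsum X)).
Hypotheses (qe : is_exponent q) (SD : S `<=` in_D d A q).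
Hypothesis Svan : unif_vanishing d A q S.

Variables (J : Type) (G : set_system J) (s : J -> fsum X).
Hypotheses (GU : UltraFilter G) (Gs : G [set j | S (s j)]).

(* [B n] bounds the number of points at distance at least [scale n] from [A],
   which [t j n] lists. A point of [s j] of level [n] gets the label [(n, k)]
   with [k] its position in this list: labels are common to all [j], and
   finitely many of them belong to a given level. *)
Variables (B : nat -> nat) (t : J -> nat -> seq nat).
Hypothesis tP : forall j n, S (s j) ->
  (size (t j n) <= B n)%N /\ idx (u_ d A (scale n)%:E (s j)) `<=` [set` t j n].

Definition labelled j (l : nat * nat) i :=
  [/\ S (s j), idx (s j) i, level l.1 (pt (s j) i) & l.2 = index i (t j l.1)].

Lemma labelled_mem j l i : labelled j l i -> i \in t j l.1.
Proof. by move=> [Ss si [li _] _]; apply: (tP l.1 Ss).2; split. Qed.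

Lemma labelled_lt j l i : labelled j l i -> (l.2 < B l.1)%N.
Proof.
move=> /[dup] /labelled_mem il [Ss _ _ ->].
by rewrite (leq_trans _ (tP l.1 Ss).1)// index_mem.
Qed.

Lemma labelled_inj j l i i' : labelled j l i -> labelled j l i' -> i = i'.
Proof.
move=> li li'; rewrite -(nth_index 0%N (labelled_mem li)) -(nth_index 0%N (labelled_mem li')).
by case: li => _ _ _ <-; case: li' => _ _ _ <-.
Qed.

Lemma labelled_fun j l l' i : labelled j l i -> labelled j l' i -> l = l'.
Proof.
case: l l' => [n k] [n' k'] [_ _ /= ln ->] [_ _ /= /(level_unique ln) <- ->] //.
Qed.

Lemma labelled_exists j i : S (s j) -> idx (s j) i -> exists l, labelled j l i.
Proof.
move=> Ss si; have /(in_DP dA _ qe)[sD _ _] := SD Ss.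
have [n ln] := level_exists (dist_set_gt0 dA (sD i si)).
by exists (n, index i (t j n)).
Qed.

Variable iota_ : J -> nat * nat -> nat.
Hypothesis iotaP : forall j l i, labelled j l i -> labelled j l (iota_ j l).

Definition present l := G [set j | exists i, labelled j l i].

Variable x : nat * nat -> X.
Hypothesis xlim : forall l, present l -> ultralimit d G (fun j => pt (s j) (iota_ j l)) (x l).

Lemma near_label l (e : R) : present l -> 0 < e ->
  G [set j | labelled j l (iota_ j l) /\ (d (x l) (pt (s j) (iota_ j l)) < e%:E)%E].
Proof.
move=> pl e0; apply: filterS (filterI pl (xlim pl e0)) => j [[i /iotaP li] dl].
by split.
Qed.

Lemma label_point_dist_ge l : present l -> ~ (dA_ (x l) < (scale l.1)%:E)%E.
Proof.
move=> pl xl; have [r xr] : exists r, dA_ (x l) = r%:E.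
  move: xl (dist_set_ge0 dA (x l)); case: (dA_ (x l)) => [r| |]//; by exists r.
rewrite xr lte_fin -subr_gt0 in xl.
have [j [[_ _ [+ _] _] dj]] := filter_ex (near_label pl xl); apply.
apply: le_lt_trans (dist_set_triangle dA _ (x l)) _.
rewrite (ext_metric_sym dA) xr -lteBrDr// -EFinB//.
Qed.

(** The strict bound of a level becomes weak in the limit; strictness is recovered later from
    [scale N] being strictly below the thresholds. *)
Lemma label_point_dist_le l n : present l -> (n < l.1)%N -> (dA_ (x l) <= (scale n)%:E)%E.
Proof.
move=> pl nl; apply/lee_addgt0Pr => e e0.
have [j [[_ _ [_ /(_ n nl) ln] _] dj]] := filter_ex (near_label pl e0).
apply: le_trans (dist_set_triangle dA _ (pt (s j) (iota_ j l))) _.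
by rewrite addeC; apply: leeD; exact: ltW.
Qed.

Variables (enc : nat * nat -> nat) (dec : nat -> nat * nat).
Hypothesis decK : cancel enc dec.

(** Labels are encoded by integers because the index set of a formal sum is a set of naturals. *)
Definition limit_sum := FSum [set enc l | l in present] (fun m => x (dec m)).

Definition labels N := [seq (n, k) | n <- iota 0 N.+1, k <- iota 0 (B n)].

Lemma present_labels l N : present l -> (l.1 <= N)%N -> l \in labels N.
Proof.
move=> pl lN; have [j [i /labelled_lt lB]] := filter_ex pl.
apply/allpairsPdep; exists l.1, l.2; rewrite !mem_iota !add0n lB ltnS lN; split=> //.
by case: l {pl lN lB}.
Qed.

(** Fatou for norms: any finite set of limit points in the tail is approximated at once inside a
    single sum of [S], whose tail is bounded by hypothesis. *)
Lemma limit_sum_tail (e dl : R) : 0 < e -> (forall a, S a -> tail d A q a dl%:E (e / 2)) ->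
  tail d A q limit_sum dl%:E e.
Proof.
move=> e0 Sdl; apply: small_seq => [i _|u uP]; first exact: (dist_set_ge0 dA).
have /choice[r rP] : forall m, exists r : R, m \in u ->
    [/\ present (dec m), enc (dec m) = m, dA_ (x (dec m)) = r%:E, 0 < r & r < dl].
  move=> m; have [mu|] := boolP (m \in u); last by exists 0.
  have [[l pl <-] /=] := uP m mu; rewrite decK => ldl.
  have := label_point_dist_ge pl; move: ldl; case: (dA_ (x l)) => [r| |]//=.
    rewrite !lte_fin => rdl /negP; rewrite -leNgt => lr.
    by exists r => _; split=> //; rewrite (lt_le_trans (scale_gt0 _) lr).
  by move=> _ []; exact: ltNyr.
(* With [r m] the distance of the limit point to [A], closeness [r m / 2] gives [r m] at most twice
   the distance of the approximating point, and closeness [dl - r m] keeps that point in the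
   tail. *)
have [|j jP] := filter_ex (@filter_seq J nat G u (fun m => [set j |
    labelled j (dec m) (iota_ j (dec m)) /\
    (d (x (dec m)) (pt (s j) (iota_ j (dec m))) < (Num.min (r m / 2) (dl - r m))%:E)%E]) _ _).
  move=> m mu; have [pm _ _ r0 rdl] := rP m mu; apply: near_label => //.
  by rewrite lt_min divr_gt0//= subr_gt0.
(* Membership in [S] is read off from a label, so the empty list is treated apart. *)
have Ss : u != [::] -> S (s j).
  by case: (u) jP => [//|m u'] /(_ m (mem_head _ _))[[]].
have [->|/Ss {}Ss] := eqVneq u [::].
  split=> //=; case: q qe => // p _.
  by rewrite set_nil esum_set0 lee_fin powR_ge0.
rewrite (_ : e = 2 * (e / 2)); last by field.
have e20 : 0 <= e / 2 by rewrite divr_ge0// ltW.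
apply: (@small_scale _ _ _ (fun m => dA_ (pt (s j) (iota_ j (dec m))))) => //.
  move=> m /= mu; have [_ _ xr r0 rdl] := rP m mu; split; first exact: (dist_set_ge0 dA).
  have [_] := jP m mu; rewrite EFin_min lt_min => /andP[d1 _].
  have := dist_set_triangle dA (x (dec m)) (pt (s j) (iota_ j (dec m))).
  rewrite xr; move: d1 (dist_set_ge0 dA (pt (s j) (iota_ j (dec m)))) (ext_metric_ge0 dA (x (dec m)) (pt (s j) (iota_ j (dec m)))).
  case: (d _ _) => [v| |]//; case: (dA_ _) => [w| |]//; last first.
    by rewrite mulry gtr0_sg// mul1e leey.
  rewrite -EFinD -EFinM lte_fin !lee_fin; lra.
apply: (small_reindex (M := fun m i => i = iota_ j (dec m))) (Sdl _ Ss) => //.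
  move=> m m' i /= mu m'u -> E.
  have [lm _] := jP m mu; have [lm' _] := jP m' m'u.
  have [_ <- _ _ _] := rP m mu; have [_ <- _ _ _] := rP m' m'u.
  by rewrite (labelled_fun lm (l' := dec m')) // E.
move=> m /= mu; split; first exact: (dist_set_ge0 dA).
right; exists (iota_ j (dec m)); split=> //.
have [_ _ xr r0 rdl] := rP m mu.
have [[_ si _ _]] := jP m mu; rewrite EFin_min lt_min => /andP[_ d2]; split=> //=.
apply: le_lt_trans (dist_set_triangle dA _ (x (dec m))) _.
by rewrite (ext_metric_sym dA) xr -lteBrDr// -EFinB.
Qed.

Lemma limit_sum_in_D : in_D d A q limit_sum.
Proof.
apply/(in_DP dA _ qe); split=> [m [l pl <-] /=|dl dl0|e e0].
- rewrite decK => Ax; apply: (label_point_dist_ge pl); apply: le_lt_trans (dist_set_le d (x l) Ax) _.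
  by rewrite (ext_metric_xx dA) lte_fin scale_gt0.
- have [N Ndl] := scale_lt dl0.
  apply: (@sub_finite_set _ _ [set` map enc (labels N)]); last exact: finite_seq.
  move=> m [[l pl <-] /= ldl]; apply: map_f; apply: present_labels => //.
  rewrite leqNgt; apply/negP => Nl; apply: ldl; rewrite decK.
  by apply: le_lt_trans (label_point_dist_le pl Nl) _; rewrite lte_fin.
- have e20 : 0 < e / 2 by rewrite divr_gt0.
  by have [dl dl0 Sdl] := Svan e20; exists dl => //; exact: limit_sum_tail.
Qed.

(** Cut at a level [N] beyond which both sums lie in their tails, and match points up to level [N]
    by equality of labels. The two parts of each norm get [e / 2] each. *)
Lemma limit_sum_coupled (e : R) : 0 < e -> G [set j | coupled d A q limit_sum (s j) e].
Proof.
move=> e0; have e20 : 0 < e / 2 by rewrite divr_gt0.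
have eE : e = 2 * (e / 2) by field.
have [dl dl0 Sdl] := Svan e20.
have /(in_DP dA _ qe)[_ _ /(_ _ e20)[dl' dl'0 ldl']] := limit_sum_in_D.
have [N] : exists N, scale N < Num.min dl dl' by apply: scale_lt; rewrite lt_min dl0.
rewrite lt_min => /andP[Ndl Ndl'].
have [eta eta0 etaP] := small_finite (map enc (labels N)) qe e20.
(* Absent labels matter too: by maximality of [G] each of them almost surely does not occur, so no
   point of [s j] up to level [N] is left without a partner. *)
have near_labels : G [set j | forall l, l \in labels N ->
    (present l -> labelled j l (iota_ j l) /\ (d (x l) (pt (s j) (iota_ j l)) < eta%:E)%E) /\
    (~ present l -> forall i, ~ labelled j l i)].
  apply: filter_seq => l _; have [pl|npl] := pselect (present l).
    by apply: filterS (near_label pl eta0) => j jl; split.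
  have [//|] := in_ultra_setVsetC [set j | exists i, labelled j l i] GU.
  by apply: filterS => j nl; split=> // _ i li; apply: nl; exists i.
apply: filterS (filterI Gs near_labels) => j [/= Ss jP].
pose M m i := exists l, [/\ enc l = m, (l.1 <= N)%N, present l & labelled j l i].
pose f m : \bar R := if ((dec m).1 <= N)%N then eta%:E else dA_ (x (dec m)).
pose g i : \bar R := if `[<exists m, M m i>] then eta%:E else dA_ (pt (s j) i).
have f0 m : (0 <= f m)%E.
  by rewrite /f; case: ifP => _; [rewrite lee_fin ltW|exact: (dist_set_ge0 dA)].
have g0 i : (0 <= g i)%E.
  by rewrite /g; case: ifP => _; [rewrite lee_fin ltW|exact: (dist_set_ge0 dA)].
have Mdist m i : M m i -> (d (pt limit_sum m) (pt (s j) i) <= eta%:E)%E.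
  move=> [l [<- lN pl li]] /=; rewrite decK.
  have [/(_ pl)[li' dl_]] := jP _ (present_labels pl lN).
  by rewrite (labelled_inj li li') ltW.
have low l i : labelled j l i -> (l.1 <= N)%N -> present l.
  move=> li lN; apply: contrapT => npl.
  have [|_ /(_ npl)/(_ _ li)//] := jP l _.
  apply/allpairsPdep; exists l.1, l.2; rewrite !mem_iota !add0n ltnS lN (labelled_lt li).
  by split=> //; case: l {li lN npl}.
exists M, f, g; split.
- split.
  + by move=> m i [l [<- lN pl [_ si _ _]]]; split=> //; exists l.
  + move=> m m' i [l [<- _ _ li]] [l' [<- _ _ li']].
    by rewrite (labelled_fun li li').
  + move=> m i i' [l [<- _ _ li]] [l' [/(can_inj decK) -> _ _ li']].
    exact: labelled_inj li li'.
  + move=> m i Mmi; have dmi := Mdist _ _ Mmi; rewrite /f /g asboolT; last by exists m.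
    by case: Mmi dmi => l [<- lN _ _]; rewrite decK lN.
  + move=> _ [l pl <-] nM; rewrite /f /= decK; case: ifP => // lN.
    have [/(_ pl)[li _] _] := jP _ (present_labels pl lN).
    by exfalso; apply: (nM (iota_ j l)); exists l.
  + move=> i si nM; rewrite /g; case: asboolP => // -[m Mmi].
    by case: (nM m).
- rewrite eE (_ : idx limit_sum = (idx limit_sum `&` [set m | ((dec m).1 <= N)%N]) `|`
    (idx limit_sum `&` [set m | ~~ ((dec m).1 <= N)%N])); last first.
    rewrite -setIUr; apply/esym/setIidPl => m _ /=; by apply/orP; rewrite orbN.
  apply: small_union => //; first exact: ltW.
    apply: etaP => [_ [[l pl <-] /=]|m [_ /= mN]]; last by rewrite f0 /f mN.
    by rewrite decK => lN; apply: map_f; exact: present_labels.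
  apply: small_le ldl' => //; first exact: ltW.
    move=> _ [[l pl <-] /=]; rewrite decK -ltnNge => Nl; split; first by exists l.
    by rewrite (le_lt_trans (label_point_dist_le pl Nl))// lte_fin.
  by move=> m [_ /= /negPf mN]; rewrite f0 /f mN.
- rewrite eE (_ : idx (s j) = (idx (s j) `&` [set i | exists m, M m i]) `|`
    (idx (s j) `&` [set i | ~ exists m, M m i])); last first.
    rewrite -setIUr; apply/esym/setIidPl => i _ /=; exact: EM.
  apply: small_union => //; first exact: ltW.
    (* [eta] was chosen for the fixed list of labels, whereas the indices in [s j] vary with [j];
       the bound is carried over along [M]. *)
    apply: (@small_reindex _ _ _ [set` map enc (labels N)] _ (fun=> eta%:E) _ (fun i m => M m i)) => //.
    + move=> i i' m _ _ [l [<- _ _ li]] [l' [/(can_inj decK) -> _ _ li']].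
      exact: labelled_inj li li'.
    + move=> i [si [m Mmi]]; split=> //; right; exists m; split=> //.
        case: Mmi => l [<- lN pl _]; apply: map_f; exact: present_labels.
      by rewrite /g asboolT//; exists m.
    + exact: ltW.
    + by apply: etaP => // i _; rewrite lee_fin ltW.
  apply: small_le (Sdl _ Ss) => //; first exact: ltW.
    move=> i [si nM]; split=> //=; have [l li] := labelled_exists Ss si.
    have Nl : (N < l.1)%N.
      rewrite ltnNge; apply/negP => lN; apply: nM; exists (enc l), l; split=> //.
      exact: low li lN.
    case: li => _ _ [_ /(_ _ Nl) lN] _; apply: lt_trans lN _.
    by rewrite lte_fin.
  by move=> i [_ nM]; rewrite g0 /g asboolF.
Qed.

Lemma labels_ultralimit : exists2 a, in_D d A q a & ultralimit (W d A q) G s a.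
Proof.
exists limit_sum; first exact: limit_sum_in_D.
move=> e e0; have e80 : 0 < e / 8 by rewrite divr_gt0.
apply: filterS (filterI Gs (limit_sum_coupled e80)) => j [/= Ss c].
apply: (W_of_coupled dA qe e0 _ _ c).
  by have /(in_DP dA _ qe)[] := limit_sum_in_D.
by have /(in_DP dA _ qe)[] := SD Ss.
Qed.

End Sufficiency.

(** * From the three conditions to ultralimits, and the equivalence for every exponent *)

Section Characterization.
Context {R : realType} {X : Type} (d : X -> X -> \bar R) (A : set X).
Hypothesis dA : metric_pair d A.
Implicit Types (q : option R) (S : set (fsum X)).

Lemma ultraconvergent_of_conditions q S : is_exponent q -> S `<=` in_D d A q ->
  unif_upper_finite d A S -> upper_rel_compact d A S -> unif_vanishing d A q S ->
  ultraconvergent (W d A q) (in_D d A q) S.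
Proof.
move=> qe SD fin comp van J G s GU Gs.
(* Since [X] may be empty, default points are taken from the sum [s j0]. *)
have [j0 _] := filter_ex Gs.
have /choice[B BP] : forall n, exists k : nat, forall a, S a ->
    exists t : seq nat, (size t <= k)%N /\ idx (u_ d A (scale n)%:E a) `<=` [set` t].
  move=> n; have [M [M0 MP]] := fin _ (scale_gt0 n).
  exists (Num.bound M) => a /MP[t tM ut]; exists t; split=> //.
  by rewrite -(ler_nat R) (le_trans tM)// ltW// archi_boundP.
have /choice[t tP] : forall jn : J * nat, exists t : seq nat, S (s jn.1) ->
    (size t <= B jn.2)%N /\ idx (u_ d A (scale jn.2)%:E (s jn.1)) `<=` [set` t].
  move=> [j n] /=; have [Sj|nS] := pselect (S (s j)).
    by have [t tt] := BP n _ Sj; exists t.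
  by exists [::] => /nS.
have tP' j n := tP (j, n); rewrite /= in tP'.
pose lab := labelled d A S s (fun j n => t (j, n)).
have /choice[io ioP] : forall jl : J * (nat * nat), exists i, forall i', lab jl.1 jl.2 i' -> lab jl.1 jl.2 i.
  move=> [j l] /=; have [[i li]|n] := pselect (exists i, lab j l i); first by exists i.
  by exists 0%N => i li; case: n; exists i.
have ioP' j l := ioP (j, l); rewrite /= in ioP'.
have /choice[x xP] : forall l, exists x, present d A S G s (fun j n => t (j, n)) l ->
    ultralimit d G (fun j => pt (s j) (io (j, l))) x.
  move=> l; have [pl|npl] := pselect (present d A S G s (fun j n => t (j, n)) l); last first.
    by exists (pt (s j0) 0%N) => /npl.
  (* Points labelled [l] lie in the upper part at [scale l.1], which upper relative compactness
     makes ultraconvergent. *)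
  have [||y _ ylim] := (rel_compact_ultraP (metric_weak_metric dA) _).1 (comp _ (scale_gt0 l.1)) J G
      (fun j => pt (s j) (io (j, l))) GU => //; last by exists y.
  apply: filterS pl => j [i /ioP'[Ss si [li _] _]].
  by exists (s j) => //; exists (io (j, l)).
have [enc [dec decK]] : exists (enc : nat * nat -> nat) (dec : nat -> nat * nat), cancel enc dec.
  exists pickle, (fun m => odflt (0%N, 0%N) (unpickle m)) => l.
  by rewrite pickleK.
exact: (labels_ultralimit dA qe SD van GU Gs tP' ioP' xP decK).
Qed.

Lemma rel_compactP q S : is_exponent q -> S `<=` in_D d A q ->
  rel_compact_in (W d A q) (in_D d A q) S <->
  [/\ unif_upper_finite d A S, upper_rel_compact d A S & unif_vanishing d A q S].
Proof.
move=> qe SD.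
have DD : in_D d A q `<=` in_Dbar A by move=> a /(in_DP dA _ qe)[].
have Ww := weak_metric_sub DD (W_weak_metric dA qe).
apply: iff_trans (rel_compact_ultraP Ww SD) _; split=> [H|[fin comp van]].
  split; first exact: ultraconvergent_unif_upper_finite H.
    exact: ultraconvergent_upper_rel_compact H.
  exact: ultraconvergent_unif_vanishing H.
exact: ultraconvergent_of_conditions.
Qed.

End Characterization.

Unset Implicit Arguments.

Theorem theorem7p34 (R : realType) (X : Type) (d : X -> X -> \bar R) (A : set X) :
  metric_pair d A ->
  (forall S : set (fsum X),
     S `<=` in_Dinf d A ->
     (rel_compact_in (Winf d A) (in_Dinf d A) S <->
      unif_upper_finite d A S /\ upper_rel_compact d A S)) /\
  (forall (p : R), 1 <= p -> forall S : set (fsum X),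
     S `<=` in_Dp d A p ->
     (rel_compact_in (Wp d A p) (in_Dp d A p) S <->
      [/\ unif_upper_finite d A S, upper_rel_compact d A S &
          unif_p_vanishing d A p S])).
Proof.
move=> dA; split=> [S SD|p p1 S SD].
  apply: iff_trans (rel_compactP dA (q := None) isT SD) _; split=> [[]//|[fin comp]].
  (* In the sup norm a tail below [e] has norm at most [e], so uniform vanishing is automatic. *)
  by split=> // e e0; exists e => // a _; split=> i [_ /ltW//] _; exact: (dist_set_ge0 dA).
apply: iff_trans (rel_compactP dA (q := Some p) p1 SD) _.
by split=> -[? ? V]; split=> //; apply/(unif_p_vanishingP dA p1 SD).
Qed.
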